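(* Let $u^0\in\mathcal U$ be any initial guess and let $(u^k)_{k\ge 0}$ be a sequence of controls in $\mathcal U$ produced by the needle-type algorithm described in the context; that is, for every $k\ge 0$ the control $u^{k+1}$ is obtained from $u^k$ by the following steps. 1. Let $\Phi$ be the flow of $(t,x)\mapsto \mathbf v(t,x,u^k(t))$, let $A^t=\Phi_{T,t}(A)$, and let $\rho$ be the density corresponding to $u^k$. 2. Choose a measurable $w:[0,T]\to U$ such that, for each $t\in[0,T]$, $$w(t)\in\operatorname*{argmin}_{\omega\in U}\int_{\partial A^t}\rho(t,x)\,\mathbf v(t,x,\omega)\cdot\mathbf n_{A^t}(x)\,d\sigma(x).$$ 3. Put $$g(t)=\int_{\partial A^t}\rho(t,x)\left[\mathbf v(t,x,u^k(t))-\mathbf v(t,x,w(t))\right]\cdot\mathbf n_{A^t}(x)\,d\sigma(x).$$ 4. For each $\epsilon\in(0,T]$ choose a measurable set $I(\epsilon)\subset[0,T]$ with $\mathcal L^1(I(\epsilon))=\epsilon$ that maximizes $\int_\iota g(t)\,dt$ among all measurable $\iota\subset[0,T]$ with $\mathcal L^1(\iota)=\epsilon$. 5. For each $\epsilon\in(0,T]$ let $u_{w,I(\epsilon)}(t)=w(t)$ for $t\in I(\epsilon)$ and $u_{w,I(\epsilon)}(t)=u^k(t)$ otherwise. 6. Choose $\epsilon^*\in(0,T]$ that maximizes $\epsilon\mapsto J[u_{w,I(\epsilon)}]$ over $(0,T]$. 7. Set $u^{k+1}=u_{w,I(\epsilon^* )}$. Then $$J[u^{k+1}]\ \ge\ J[u^k]\qquad\text{for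 all } k.$$
   Context: Problem. Fix $T>0$, a nonempty compact set $U\subset\mathbb R^m$, a map $\mathbf v:[0,T]\times\mathbb R^n\times U\to\mathbb R^n$, an initial density $\rho_0:\mathbb R^n\to\mathbb R$ and a target set $A\subset\mathbb R^n$. The set of admissible controls is $$\mathcal U=\{u:[0,T]\to\mathbb R^m \text{ measurable},\ u(t)\in U\text{ for a.e. }t\in[0,T]\}.$$ For $u\in\mathcal U$ the density $\rho=\rho(t,x)$ corresponding to $u$ is the solution of the continuity equation $$\rho_t+\operatorname{div}_x\big(\mathbf v(t,x,u(t))\,\rho\big)=0,\qquad \rho(0,x)=\rho_0(x),$$ given explicitly by $\rho(t,x)=\rho_0(y)/\det D\Phi_{0,t}(y)$ with $y=\Phi_{t,0}(x)$, where $\Phi$ is the flow of the vector field $(t,x)\mapsto\mathbf v(t,x,u(t))$. The functional to be maximized over $\mathcal U$ is $$J[u]=\int_A\rho(T,x)\,dx .$$ Notation. For a time-dependent vector field $\mathbf w(t,x)$, its flow is $\Phi_{s,t}(x)=y(t)$, where $y$ solves $\dot y(t)=\mathbf w(t,y(t))$, $y(s)=x$. Given the flow, $A^t=\Phi_{T,t}(A)$. $\mathbf n_{A^t}(x)$ is the measure-theoretic outer unit normal to $A^t$ at $x$ (with the usual convention that it is $0$ at points where no such normal exists), $\sigma$ is the $(n-1)$-dimensional Hausdorff measure, and $\mathcal L^1$ is the Lebesgue measure on $\mathbb R$. Standing assumptions. - $\mathbf v:[0,T]\times\mathbb R^n\times U\to\mathbb R^n$ is continuous. - For all $t\in[0,T]$,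 $u\in U$ the map $x\mapsto\mathbf v(t,x,u)$ is twice continuously differentiable. - There are constants $L,C>0$ with $|\mathbf v(t,x,u)-\mathbf v(t,x',u)|\le L|x-x'|$ and $|\mathbf v(t,x,u)|\le C(1+|x|)$ for all $t\in[0,T]$, $u\in U$, $x,x'\in\mathbb R^n$. - $\rho_0$ is continuously differentiable. - $A$ is a compact tubular neighbourhood: a compact set that is a union of closed $n$-dimensional balls of a certain fixed radius $r>0$. - (Assumed to guarantee existence of an optimal control.) $\mathbf v(t,x,u)=\mathbf v_0(t,x)+\sum_{i=1}^l\phi_i(t,u)\,\mathbf v_i(t,x)$ for some vector fields $\mathbf v_0,\dots,\mathbf v_l$ and real-valued functions $\phi_i$, and for each $t$ the set $\{(\phi_1(t,u),\dots,\phi_l(t,u)) : u\in U\}\subset\mathbb R^l$ is convex. *)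

(* Defs.v *)
From HB Require Import structures.
From mathcomp Require Import all_boot all_order all_algebra.
From mathcomp Require Import all_classical all_reals all_analysis.

Set Implicit Arguments.
Unset Strict Implicit.
Unset Printing Implicit Defensive.
Import Order.TTheory GRing.Theory Num.Theory.
Import numFieldNormedType.Exports.
Local Open Scope classical_set_scope.
Local Open Scope ring_scope.

(* Euclidean structure: the canonical norm of 'rV[R]_n is the max norm (same
   topology), so |x| and x . y have to be introduced separately. *)
Definition dot (R : realType) (n : nat) (x y : 'rV[R]_n) : R :=
  \sum_(i < n) x ord0 i * y ord0 i.

Definition enorm (R : realType) (n : nat) (x : 'rV[R]_n) : R :=
  Num.sqrt (dot x x).

Definition eball (R : realType) (n : nat) (c : 'rV[R]_n) (r : R) :
  set 'rV[R]_n := [set y | enorm (y - c) <= r].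

Definition frontier (T : topologicalType) (A : set T) : set T :=
  closure A `\` interior A.

(* The outer measure generated by a gauge tau through countable covers; giving a
   set the gauge +oo excludes it from the covers. *)
Definition cover_outer (R : realType) (T : Type) (tau : set T -> \bar R)
    (X : set T) : \bar R :=
  ereal_inf [set (\sum_(k <oo) tau (F k))%E
            | F in [set F : (set T)^nat | X `<=` \bigcup_k F k]].

Section cover_outer_theory.
Local Open Scope ereal_scope.
Variables (R : realType) (T : Type) (tau : set T -> \bar R).
Hypotheses (tau0 : tau set0 = 0) (tau_ge0 : forall X, 0 <= tau X).

Lemma le_cover_outer : {homo cover_outer tau : A B / A `<=` B >-> A <= B}.
Proof.
move=> A B AB; apply/ereal_inf_le_tmp => x [F BF <-].
by exists F => //; apply: subset_trans AB BF.
Qed.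

Lemma cover_outer_ge0 A : 0 <= cover_outer tau A.
Proof. by apply: le_ereal_inf_tmp => x [F _ <-]; exact: nneseries_ge0. Qed.

Lemma cover_outer0 : cover_outer tau set0 = 0.
Proof.
apply/eqP; rewrite eq_le cover_outer_ge0 andbT.
apply: ereal_inf_lbound; exists (fun=> set0) => //.
by apply: eseries0 => k _ _; rewrite tau0.
Qed.

Lemma cover_outer_sigma_subadditive : sigma_subadditive (cover_outer tau).
Proof.
move=> A; have [[i ioo]|] := pselect (exists i, cover_outer tau (A i) = +oo).
  rewrite (eseries_pinfty _ _ ioo) ?leey// => n _.
  by rewrite -ltNye (lt_le_trans _ (cover_outer_ge0 _)).
rewrite -forallNE => Aoo.
suff add2e (e : {posnum R}) : cover_outer tau (\bigcup_n A n) <=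
    \sum_(i <oo) cover_outer tau (A i) + e%:num%:E.
  by apply/lee_addgt0Pr => _/posnumP[].
rewrite (le_trans _ (epsilon_trick _ _ _))//; last first.
  by move=> n; exact: cover_outer_ge0.
pose P n (B : (set T)^nat) := (A n `<=` \bigcup_k B k) /\
  \sum_(k <oo) tau (B k) <= cover_outer tau (A n) + (e%:num / (2 ^ n.+1)%:R)%:E.
have [G PG] : {G : ((set T)^nat)^nat & forall n, P n (G n)}.
  apply: (@choice _ _ P) => n; rewrite /P /cover_outer.
  set S := (X in ereal_inf X); move infS : (ereal_inf S) => iS.
  case: iS infS => [r Sr|Soo|Soo].
  - have en1 : (0 < e%:num / (2 ^ n.+1)%:R)%R by [].
    have /(lb_ereal_inf_adherent en1) : ereal_inf S \is a fin_num by rewrite Sr.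
    move=> [x [B AnB muBx] xS].
    by exists B; split => //; rewrite muBx -Sr; exact/ltW.
  - by have := Aoo n; rewrite /cover_outer Soo.
  - suff : lbound S 0 by move/le_ereal_inf_tmp; rewrite Soo.
    by move=> /= _ [B AnB <-]; exact: nneseries_ge0.
have tauG_ge0 x : 0 <= (tau \o uncurry G) x by exact: tau_ge0.
apply: (@le_trans _ _ (\esum_(i in setT) (tau \o uncurry G) i)).
  rewrite /cover_outer; apply: ereal_inf_lbound => /=.
  have /card_esym/ppcard_eqP[f] := card_nat2.
  exists (uncurry G \o f).
    apply: (@subset_trans _ (\bigcup_n \bigcup_k G n k)) => [t [i _]|].
      by move=> /((PG i).1) -[j _ ?]; exists i => //; exists j.
    move=> t [i _ [j _ Bijt]]; exists (f^-1%FUN (i, j)) => //=.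
    by rewrite invK ?inE.
  rewrite -(esum_pred_image (tau \o uncurry G) _ xpredT) ?[fun=> _]set_true//.
  by rewrite image_eq.
rewrite (_ : esum _ _ = \sum_(i <oo) \sum_(j <oo ) tau (G i j)); last first.
  pose J : nat -> set (nat * nat) := fun i => [set (i, j) | j in setT].
  rewrite (_ : setT = \bigcup_k J k); last first.
    by rewrite predeqE => -[a b]; split => // _; exists a => //; exists b.
  rewrite esum_bigcupT /=; last 2 first.
    - apply/trivIsetP => i j _ _ ij.
      rewrite predeqE => -[n m] /=; split => //= -[] [_] _ [<-{n} _].
      by move=> [m' _] [] /esym/eqP; rewrite (negbTE ij).
    - by move=> /= [n m]; exact: tau_ge0.
  rewrite -(image_id [set: nat]) -fun_true esum_pred_image//; last first.
    by move=> n _; exact: esum_ge0.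
  apply: eq_eseriesr => /= j _.
  rewrite -(esum_pred_image (tau \o uncurry G) (pair j) predT)//=; last first.
    by move=> ? ? _ _; exact: (@can_inj _ _ _ snd).
  by congr esum; rewrite predeqE => -[a b]; split; move=> [i _ <-]; exists i.
apply: lee_lim.
- apply: is_cvg_nneseries => n *.
  by apply: nneseries_ge0 => m *; exact: (tauG_ge0 (n, m)).
- by apply: is_cvg_nneseries => n *; apply: adde_ge0 => //; exact: cover_outer_ge0.
- by near=> n; apply: lee_sum => i _; exact: (PG i).2.
Unshelve. all: by end_near. Qed.

End cover_outer_theory.

(* n-dimensional Lebesgue (outer) measure: covers by closed boxes. *)
Definition box (R : realType) (n : nat) (a b : 'rV[R]_n) : set 'rV[R]_n :=
  [set x | forall i, a ord0 i <= x ord0 i <= b ord0 i].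

Definition box_gauge (R : realType) (n : nat) (X : set 'rV[R]_n) : \bar R :=
  if X == set0 then 0%E
  else ereal_inf [set (\prod_(i < n) (ab.2 ord0 i - ab.1 ord0 i))%:E
                 | ab in [set ab : 'rV[R]_n * 'rV[R]_n |
                           (forall i, ab.1 ord0 i <= ab.2 ord0 i) /\
                           X = box ab.1 ab.2]].

Definition lebesgue_outer (R : realType) (n : nat) : set 'rV[R]_n -> \bar R :=
  cover_outer (@box_gauge R n).

(* s-dimensional Hausdorff (outer) measure on R^n, normalised by the volume
   of the unit ball of R^s as usual. *)
Definition ediam (R : realType) (n : nat) (X : set 'rV[R]_n) : \bar R :=
  ereal_sup [set (enorm (p.1 - p.2))%:E
            | p in [set p : 'rV[R]_n * 'rV[R]_n | X p.1 /\ X p.2]].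

Definition unit_ball_volume (R : realType) (s : nat) : R :=
  fine (lebesgue_outer (eball (0 : 'rV[R]_s) 1)).

Definition hausdorff_gauge (R : realType) (n s : nat) (delta : R)
    (X : set 'rV[R]_n) : \bar R :=
  if X == set0 then 0%E
  else if (ediam X <= delta%:E)%E
  then (unit_ball_volume R s * (fine (ediam X) / 2) ^+ s)%:E
  else +oo%E.

Definition hausdorff_outer (R : realType) (n s : nat) (X : set 'rV[R]_n) : \bar R :=
  ereal_sup [set cover_outer (hausdorff_gauge s delta) X
            | delta in [set delta : R | 0 < delta]].

Section outer_measure_instances.
Local Open Scope ereal_scope.
Variable R : realType.

Lemma box_gauge0 n : box_gauge (set0 : set 'rV[R]_n) = 0.
Proof. by rewrite /box_gauge eqxx. Qed.

Lemma box_gauge_ge0 n (X : set 'rV[R]_n) : 0 <= box_gauge X.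
Proof.
rewrite /box_gauge; case: ifP => // _.
apply: le_ereal_inf_tmp => _ [[a b] /= [ab _] <-]; rewrite lee_fin.
by apply: prodr_ge0 => i _; rewrite subr_ge0.
Qed.

HB.instance Definition _ n :=
  isOuterMeasure.Build R 'rV[R]_n (@lebesgue_outer R n)
    (cover_outer0 (box_gauge0 n) (@box_gauge_ge0 n))
    (cover_outer_ge0 (@box_gauge_ge0 n))
    (@le_cover_outer _ _ (@box_gauge R n))
    (cover_outer_sigma_subadditive (@box_gauge_ge0 n)).

Variables n s : nat.
Implicit Types X : set 'rV[R]_n.

Lemma hausdorff_gauge0 delta :
  hausdorff_gauge s delta (set0 : set 'rV[R]_n) = 0.
Proof. by rewrite /hausdorff_gauge eqxx. Qed.

Lemma hausdorff_gauge_ge0 delta X : 0 <= hausdorff_gauge s delta X.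
Proof.
rewrite /hausdorff_gauge; case: ifPn => // /set0P[x Xx]; case: ifP => // _.
rewrite lee_fin mulr_ge0//.
  exact/fine_ge0/cover_outer_ge0/box_gauge_ge0.
rewrite exprn_ge0// divr_ge0// fine_ge0//.
apply: (@le_trans _ _ (enorm (x - x))%:E); first by rewrite lee_fin sqrtr_ge0.
by apply: ereal_sup_ubound; exists (x, x).
Qed.

Lemma hausdorff_outer0 : hausdorff_outer s (set0 : set 'rV[R]_n) = 0.
Proof.
apply/eqP; rewrite eq_le; apply/andP; split.
  apply: ge_ereal_sup => _ [delta _ <-]; rewrite cover_outer0//.
    exact: hausdorff_gauge0.
  exact: hausdorff_gauge_ge0.
apply: ereal_sup_ubound; exists 1%R; rewrite //= cover_outer0//.
  exact: hausdorff_gauge0.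
exact: hausdorff_gauge_ge0.
Qed.

Lemma hausdorff_outer_ge0 X : 0 <= hausdorff_outer s X.
Proof.
apply: (le_trans (cover_outer_ge0 (@hausdorff_gauge_ge0 1) X)).
by apply: ereal_sup_ubound; exists 1%R => /=.
Qed.

Lemma le_hausdorff_outer :
  {homo @hausdorff_outer R n s : A B / A `<=` B >-> A <= B}.
Proof.
move=> A B AB; apply: ge_ereal_sup => _ [delta delta0 <-].
apply: (le_trans (le_cover_outer _ AB)).
by apply: ereal_sup_ubound; exists delta.
Qed.

Lemma hausdorff_outer_sigma_subadditive : sigma_subadditive (@hausdorff_outer R n s).
Proof.
move=> F; apply: ge_ereal_sup => _ [delta delta0 <-].
apply: (le_trans (cover_outer_sigma_subadditive (hausdorff_gauge_ge0 delta) F)).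
apply: lee_nneseries => [i _ _|i _].
  exact/cover_outer_ge0/hausdorff_gauge_ge0.
by apply: ereal_sup_ubound; exists delta.
Qed.

HB.instance Definition _ :=
  isOuterMeasure.Build R 'rV[R]_n (@hausdorff_outer R n s)
    hausdorff_outer0 hausdorff_outer_ge0 le_hausdorff_outer
    hausdorff_outer_sigma_subadditive.

End outer_measure_instances.

(* The corresponding complete measures on the Caratheodory-measurable sets; for
   lebesgue_rV these are exactly the Lebesgue measurable subsets of R^n. *)
Section caratheodory_measures.
Variables (R : realType) (n : nat).

Definition lebesgue_rV :
  set (caratheodory_type (@lebesgue_outer R n)) -> \bar R :=
  @lebesgue_outer R n.

Let leb0 : lebesgue_rV set0 = 0%E.
Proof. exact: outer_measure0. Qed.

Let leb_ge0 (X : set _) : (0 <= lebesgue_rV X)%E.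
Proof. exact: outer_measure_ge0. Qed.

Let leb_sigma_additive : semi_sigma_additive lebesgue_rV.
Proof. exact: (@caratheodory_measure_sigma_additive _ _ (@lebesgue_outer R n : {outer_measure set _ -> \bar R})). Qed.

HB.instance Definition _ := isMeasure.Build _ _ _ lebesgue_rV
  leb0 leb_ge0 leb_sigma_additive.

Definition hausdorff_rV (s : nat) :
  set (caratheodory_type (@hausdorff_outer R n s)) -> \bar R :=
  @hausdorff_outer R n s.

Let haus0 s : (@hausdorff_rV s) set0 = 0%E.
Proof. exact: outer_measure0. Qed.

Let haus_ge0 s (X : set _) : (0 <= (@hausdorff_rV s) X)%E.
Proof. exact: outer_measure_ge0. Qed.

Let haus_sigma_additive s : semi_sigma_additive (@hausdorff_rV s).
Proof. exact: (@caratheodory_measure_sigma_additive _ _ (@hausdorff_outer R n s : {outer_measure set _ -> \bar R})). Qed.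

HB.instance Definition _ (s : nat) := isMeasure.Build _ _ _ (@hausdorff_rV s)
  (@haus0 s) (@haus_ge0 s) (@haus_sigma_additive s).

End caratheodory_measures.
Arguments lebesgue_rV {R} n.
Arguments hausdorff_rV {R} n s.

(* One-dimensional Lebesgue measure is the library's completed measure, so that
   "measurable" means Lebesgue (not only Borel) measurable. *)
Definition lebesgue_measurable (R : realType) (X : set R) : Prop :=
  measurable (X : set (caratheodory_type (@wlength R idfun)^*%mu)).

Definition rV_measurable_fun (R : realType) (m : nat) (D : set R)
    (f : R -> 'rV[R]_m) : Prop :=
  forall i, measurable_fun
    (D : set (caratheodory_type (@wlength R idfun)^*%mu))
    (fun t => f t ord0 i : measurableTypeR R).

Definition C1 (R : realType) (V W : normedModType R) (f : V -> W) : Prop :=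
  (forall x, differentiable f x) /\ forall e, continuous ('D_e f).

Definition C2 (R : realType) (V W : normedModType R) (f : V -> W) : Prop :=
  C1 f /\ forall e, C1 ('D_e f).

(* Federer's measure-theoretic exterior unit normal of E at x. *)
Definition is_outer_normal (R : realType) (n : nat) (E : set 'rV[R]_n)
    (x nu : 'rV[R]_n) : Prop :=
  [/\ enorm nu = 1,
      (lebesgue_outer (eball x r `&` E `&` [set y | (0 < dot (y - x) nu)%R])
         * (r ^- n)%:E)%E @[r --> 0^'+] --> (0 : \bar R) &
      (lebesgue_outer ((eball x r `\` E) `&` [set y | (dot (y - x) nu < 0)%R])
         * (r ^- n)%:E)%E @[r --> 0^'+] --> (0 : \bar R)].

Definition outer_normal (R : realType) (n : nat) (E : set 'rV[R]_n)
    (x : 'rV[R]_n) : 'rV[R]_n :=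
  xget 0 [set nu | is_outer_normal E x nu].

Definition compact_tube (R : realType) (n : nat) (A : set 'rV[R]_n) : Prop :=
  compact A /\
  exists r : R, 0 < r /\
    exists C : set 'rV[R]_n, A = \bigcup_(c in C) eball c r.

(* \int_s^t f, with the usual sign convention when t < s. *)
Definition oriented_integral (R : realType) (s t : R) (f : R -> R) : R :=
  if s <= t then \int[completed_lebesgue_measure]_(tau in `[s, t]) f tau
  else - \int[completed_lebesgue_measure]_(tau in `[t, s]) f tau.

(* Since w is only measurable in time, y' = w(t, y), y(s) = x is understood in
   the sense of Caratheodory, on the whole of [0, T]. *)
Definition solves_ode (R : realType) (n : nat) (T : R)
    (w : R -> 'rV[R]_n -> 'rV[R]_n) (s : R) (x : 'rV[R]_n)
    (y : R -> 'rV[R]_n) : Prop :=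
  forall i,
    completed_lebesgue_measure.-integrable `[0, T]
      (fun tau => (w tau (y tau) ord0 i)%:E) /\
    forall t : R, 0 <= t <= T ->
      y t ord0 i = x ord0 i + oriented_integral s t (fun tau => w tau (y tau) ord0 i).

(* flow T w s t is Phi_{s,t}; meaningful for s and t in [0, T], on which the
   solution is unique when w is Lipschitz in x. *)
Definition flow (R : realType) (n : nat) (T : R)
    (w : R -> 'rV[R]_n -> 'rV[R]_n) (s t : R) (x : 'rV[R]_n) : 'rV[R]_n :=
  xget (fun=> x) [set y | solves_ode T w s x y] t.

Section control_problem.
Variables (R : realType) (n m : nat) (T : R) (U : set 'rV[R]_m).
Variable v : R -> 'rV[R]_n -> 'rV[R]_m -> 'rV[R]_n.
Variables (rho0 : 'rV[R]_n -> R) (A : set 'rV[R]_n).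

(* A control is a function on R of which only the values on [0, T] matter. *)
Definition admissible (u : R -> 'rV[R]_m) : Prop :=
  rV_measurable_fun `[0, T] u /\
  {ae completed_lebesgue_measure, forall t : R, 0 <= t <= T -> U (u t)}.

Definition cflow (u : R -> 'rV[R]_m) (s t : R) : 'rV[R]_n -> 'rV[R]_n :=
  flow T (fun tau x => v tau x (u tau)) s t.

Definition density (u : R -> 'rV[R]_m) (t : R) (x : 'rV[R]_n) : R :=
  let y := cflow u t 0 x in rho0 y / \det (jacobian (cflow u 0 t) y).

Definition J (u : R -> 'rV[R]_m) : R :=
  \int[lebesgue_rV n]_(x in A) density u T x.

Definition target_at (u : R -> 'rV[R]_m) (t : R) : set 'rV[R]_n :=
  cflow u T t @` A.

Definition boundary_flux (u : R -> 'rV[R]_m) (t : R)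
    (b : 'rV[R]_n -> 'rV[R]_n) : R :=
  \int[hausdorff_rV n n.-1]_(x in frontier (target_at u t))
    (density u t x * dot (b x) (outer_normal (target_at u t) x)).

Definition is_argmin (F : 'rV[R]_m -> R) (w : 'rV[R]_m) : Prop :=
  U w /\ forall omega, U omega -> F w <= F omega.

Definition gain (u w : R -> 'rV[R]_m) (t : R) : R :=
  boundary_flux u t (fun x => v t x (u t) - v t x (w t)).

Definition maximal_gain_set (g : R -> R) (eps : R) (I : set R) : Prop :=
  let admissible_set (i : set R) :=
    [/\ lebesgue_measurable i, i `<=` `[0, T] &
        completed_lebesgue_measure i = eps%:E] in
  admissible_set I /\
  forall i, admissible_set i ->
    (\int[completed_lebesgue_measure]_(t in i) (g t)%:E <=
     \int[completed_lebesgue_measure]_(t in I) (g t)%:E)%E.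

(* patch u I w equals w on I and u elsewhere. *)
Definition needle_step (u u' : R -> 'rV[R]_m) : Prop :=
  exists (w : R -> 'rV[R]_m) (I : R -> set R) (eps' : R),
    [/\ rV_measurable_fun `[0, T] w,
        forall t : R, 0 <= t <= T ->
          is_argmin (fun omega => boundary_flux u t (fun x => v t x omega)) (w t),
        forall eps : R, 0 < eps <= T -> maximal_gain_set (gain u w) eps (I eps),
        0 < eps' <= T /\
        forall eps : R, 0 < eps <= T ->
          J (patch u (I eps) w) <= J (patch u (I eps') w) &
        forall t : R, 0 <= t <= T -> u' t = patch u (I eps') w t].

End control_problem.

(* Main.v *)
Require Import Defs.
From HB Require Import structures.
From mathcomp Require Import all_boot all_order all_algebra perm.
From mathcomp Require Import all_classical all_reals all_analysis.
From mathcomp Require Import measurable_realfun.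
From mathcomp Require Import ring lra.

Set Implicit Arguments.
Unset Strict Implicit.
Unset Printing Implicit Defensive.
Import Order.TTheory GRing.Theory Num.Theory.
Import numFieldNormedType.Exports.
Local Open Scope classical_set_scope.
Local Open Scope ring_scope.

(* No needle variation formula is needed: with eps_j = T / 2^(j+1), the perturbed
   controls u_{w,I(eps_j)} agree with u^k at almost every time for all large j
   (Borel-Cantelli), and J is continuous along such sequences, so the optimal
   eps^* does at least as well as the limit J[u^k].

   For this continuity, densities are shown to converge uniformly on the compact
   set A.  The field v(t, x, u(t)) is only measurable in t and its x-derivative
   need not be equicontinuous, hence the flow is differentiated, and its Jacobian
   shown to depend continuously on the control and the initial point, by combining
   Gronwall's inequality with dominated convergence along sequences: the distance
   between two trajectories is controlled by the L^1 norm in time of the difference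
   of the fields along one of them. *)

(** Convergence is tested along sequences because dominated convergence in time is a statement about
    sequences; [near_seq] and [near2_seq] turn the results back into statements about
    neighbourhoods. The point moves together with the control, and the index runs through any [phi]
    with [k <= phi k]: this is continuous convergence of the densities, which compactness of A
    upgrades to uniform convergence. The integral in [J] is estimated without showing that A or the
    densities are measurable for the Caratheodory sigma-algebra. A control lies in U only at almost
    every time, while the flow theory below asks for bounds at every time. Since [J] depends only on
    the almost-everywhere class of the control, u^k is first replaced by a version with values in U.
    All estimates are in the max norm; the Euclidean constants are converted once, in
    [control_caratheodory_field]. *)

Local Notation leb_time R := (caratheodory_type (@wlength R idfun)^*%mu).

(** * Lebesgue integrals on a time interval *)

Section leb_time_integral.
Variable R : realType.
Notation mu := (@completed_lebesgue_measure R).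

Lemma borel_leb_measurable (X : set R) :
  measurable (X : set (measurableTypeR R)) -> measurable (X : set (leb_time R)).
Proof. exact: sub_caratheodory. Qed.

Lemma borel_leb_measurable_fun (D : set R) (f : R -> R) :
  measurable (D : set (measurableTypeR R)) ->
  measurable_fun (D : set (measurableTypeR R)) (f : _ -> measurableTypeR R) ->
  measurable_fun (D : set (leb_time R)) (f : _ -> measurableTypeR R).
Proof. by move=> mD mf _ Y mY; apply: borel_leb_measurable; exact: mf. Qed.

Lemma leb_itv_cc (a b : R) : a <= b -> mu `[a, b] = (b - a)%:E.
Proof.
(* Both measures are the same outer measure on sets; only the sigma-algebras differ, so this change
   is a conversion. *)
move=> ab; transitivity (lebesgue_measure `[a, b] : \bar R); first by [].
rewrite lebesgue_measure_itv/= lte_fin; case: ltP => // ba.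
by have -> : a = b; [apply/le_anti; rewrite ab ba | rewrite subrr].
Qed.

Lemma itv_leb_measurable (i : interval R) : measurable ([set` i] : set (leb_time R)).
Proof. exact: borel_leb_measurable. Qed.

Lemma leb_itv_lty (a b : R) : (mu `[a, b] < +oo)%E.
Proof.
have [ab|ba] := leP a b; first by rewrite leb_itv_cc// ltry.
by rewrite set_itv_ge ?bnd_simp -?ltNge// measure0.
Qed.

Lemma continuous_leb_integrable (f : R -> R) (a b : R) :
  continuous f -> mu.-integrable `[a, b] (EFin \o f).
Proof.
move=> cf; apply: measurable_bounded_integrable.
- exact: itv_leb_measurable.
- exact: leb_itv_lty.
- apply: borel_leb_measurable_fun => //; apply: measurable_funTS.
  exact: continuous_measurable_fun.
- have /compact_bounded[M [_ mrt]] := continuous_compact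
    (@continuous_subspaceT _ _ `[a, b] f cf) (@segment_compact _ a b).
  by exists M; split; rewrite ?num_real // => ? ? ? ?; exact: mrt.
Qed.

Lemma leb_Rintegral_set1 (f : R -> R) (s : R) :
  measurable_fun ([set s] : set (leb_time R)) (EFin \o f) -> \int[mu]_(x in [set s]) f x = 0.
Proof.
move=> mf; have ms : measurable ([set s] : set (leb_time R)).
  by rewrite -set_itv1; exact: itv_leb_measurable.
have mus : mu [set s] = 0%E by have := leb_itv_cc (lexx s); rewrite set_itv1 subrr.
exact: (congr1 fine (null_set_integral ms mf mus)).
Qed.

Lemma leb_integral_expR (k d a b : R) : k != 0 -> a <= b ->
  \int[mu]_(x in `[a, b]) expR (k * x + d) =
  k^-1 * expR (k * b + d) - k^-1 * expR (k * a + d).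
Proof.
move=> k0; pose f x := expR (k * x + d).
have cf : continuous f.
  move=> x; apply: continuous_comp; last exact: continuous_expR.
  by apply: cvgD; [apply: cvgMr; exact: cvg_id|exact: cvg_cst].
rewrite le_eqVlt => /predU1P[<-|ab].
  rewrite subrr set_itv1; apply: leb_Rintegral_set1; apply/measurable_EFinP.
  rewrite -set_itv1; apply: borel_leb_measurable_fun => //.
  by apply: measurable_funTS; exact: continuous_measurable_fun.
have dF x : is_derive x (1:R) (fun x => k^-1 * f x) (f x).
  apply: is_derive_eq.
  by rewrite /f /GRing.scale/= mulr1 addr0 mulrC mulfK.
have cF : continuous (fun x => k^-1 * f x).
  by move=> x; apply: cvgMr; exact: cf.
have f0 x : 0 <= f x by exact: expR_ge0.
(* The fundamental theorem of calculus is stated for the Borel structure; the identity map pushes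
   the completed measure forward to it. *)
have -> : \int[mu]_(x in `[a, b]) f x = \int[lebesgue_measure]_(x in `[a, b]) f x.
  rewrite /Rintegral; congr fine.
  have mid : measurable_fun [set: leb_time R] (idfun : leb_time R -> measurableTypeR R).
    by apply: borel_leb_measurable_fun => //; exact: measurable_id.
  have := @ge0_integral_pushforward _ _ _ _ _ _ mid mu `[a, b] (EFin \o f).
  move=> <-//=.
  - by apply/measurable_EFinP; apply: measurable_funTS; exact: continuous_measurable_fun.
  - by move=> x _; rewrite lee_fin.
rewrite /Rintegral (@continuous_FTC2 _ f (fun x => k^-1 * f x))//.
- exact: continuous_subspaceT.
- split; first by move=> x _; case: (dF x).
  + exact/cvg_at_right_filter/cF.
  + exact/cvg_at_left_filter/cF.
- by move=> x _; rewrite derive1E; case: (dF x).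
Qed.

Lemma leb_integral_itvB (T : R) (f : R -> R) (s t : R) : 0 <= s -> s <= t -> t <= T ->
  mu.-integrable `[0, T] (EFin \o f) ->
  \int[mu]_(x in `[s, t]) f x = \int[mu]_(x in `[0, t]) f x - \int[mu]_(x in `[0, s]) f x.
Proof.
move=> s0 st tT fi.
have sub (i : interval R) : [set` i] `<=` `[0, T] -> mu.-integrable [set` i] (EFin \o f).
  by move=> iT; apply: integrableS fi => //; exact: itv_leb_measurable.
have i0t : mu.-integrable `[0, t] (EFin \o f).
  by apply: sub => x /=; rewrite !in_itv/= => /andP[-> /le_trans->].
have ist : mu.-integrable `[s, t] (EFin \o f).
  apply: sub => x /=; rewrite !in_itv/= => /andP[sx xt].
  by rewrite (le_trans s0 sx) (le_trans xt tT).
have E0 : `[0, t]%classic = `[0, s] `|` `]s, t].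
  by rewrite -itv_bndbnd_setU// bnd_simp.
have E1 : `[s, t]%classic = [set s] `|` `]s, t].
  by rewrite -set_itv1 -itv_bndbnd_setU// bnd_simp.
have ms : measurable ([set s] : set (leb_time R)).
  by rewrite -set_itv1; exact: itv_leb_measurable.
have -> : \int[mu]_(x in `[0, t]) f x =
    \int[mu]_(x in `[0, s]) f x + \int[mu]_(x in `]s, t]) f x.
  rewrite E0 Rintegral_setU//; do ?exact: itv_leb_measurable.
  - by rewrite -E0.
  - apply/disj_set2P/seteqP; split=> x //=; rewrite !in_itv/=.
    by move=> -[/andP[_ xs] /andP[]]; rewrite ltNge xs.
have -> : \int[mu]_(x in `[s, t]) f x = \int[mu]_(x in `]s, t]) f x.
  rewrite E1 Rintegral_setU//; do ?exact: itv_leb_measurable.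
  - rewrite leb_Rintegral_set1 ?add0r//.
    apply: measurable_funS (measurable_int _ ist); first exact: itv_leb_measurable.
    by rewrite E1; exact: subsetUl.
  - by rewrite -E1.
  - by apply/disj_set2P/seteqP; split=> x //=; rewrite !in_itv/= => -[-> /andP[]]; rewrite ltxx.
by rewrite addrAC subrr add0r.
Qed.
End leb_time_integral.

Section oriented_integral.
Variable R : realType.
Notation mu := (@completed_lebesgue_measure R).

Lemma leb_integrableS (T : R) (f : R -> R) (a b : R) : 0 <= a -> b <= T ->
  mu.-integrable `[0, T] (EFin \o f) -> mu.-integrable `[a, b] (EFin \o f).
Proof.
move=> a0 bT; apply: integrableS; do ?exact: itv_leb_measurable.
by move=> x /=; rewrite !in_itv/= => /andP[ax xb]; rewrite (le_trans a0 ax) (le_trans xb bT).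
Qed.

(** Primitives based at 0 make the case split on [s <= t] disappear, so additivity and linearity
    become ring identities. *)
Lemma oriented_integralE (T : R) (f : R -> R) (s t : R) :
  0 <= s <= T -> 0 <= t <= T -> mu.-integrable `[0, T] (EFin \o f) ->
  oriented_integral s t f =
  \int[mu]_(x in `[0, t]) f x - \int[mu]_(x in `[0, s]) f x.
Proof.
move=> /andP[s0 sT] /andP[t0 tT] fi; rewrite /oriented_integral; case: leP => st.
  exact: (leb_integral_itvB (T := T)).
by rewrite (leb_integral_itvB (T := T) _ (ltW st))// opprB.
Qed.

Lemma oriented_integral_itv (f : R -> R) (s t : R) :
  `|oriented_integral s t f| =
  `|\int[mu]_(x in `[Num.min s t, Num.max s t]) f x|.
Proof. by rewrite /oriented_integral; case: leP => // _; rewrite normrN. Qed.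

Lemma le_norm_oriented_integral (T : R) (f g : R -> R) (s t : R) :
  0 <= s <= T -> 0 <= t <= T ->
  mu.-integrable `[0, T] (EFin \o f) -> mu.-integrable `[0, T] (EFin \o g) ->
  (forall x, 0 <= x <= T -> `|f x| <= g x) ->
  `|oriented_integral s t f| <=
  \int[mu]_(x in `[Num.min s t, Num.max s t]) g x.
Proof.
move=> /andP[s0 sT] /andP[t0 tT] fi gi fg; rewrite oriented_integral_itv.
have m0 : 0 <= Num.min s t by rewrite le_min s0 t0.
have MT : Num.max s t <= T by rewrite ge_max sT tT.
have fi' := leb_integrableS m0 MT fi.
have mD := @itv_leb_measurable R `[Num.min s t, Num.max s t].
apply: (le_trans (le_normr_Rintegral mD fi')).
apply: le_Rintegral => //.
- exact: integrable_norm.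
- exact: leb_integrableS gi.
- move=> x /=; rewrite in_itv/= => /andP[mx xM]; apply: fg.
  by rewrite (le_trans m0 mx) (le_trans xM MT).
Qed.

Lemma norm_oriented_integral_le_cst (T B : R) (f : R -> R) (s t : R) :
  0 <= s <= T -> 0 <= t <= T ->
  mu.-integrable `[0, T] (EFin \o f) ->
  (forall x, 0 <= x <= T -> `|f x| <= B) ->
  `|oriented_integral s t f| <= B * `|t - s|.
Proof.
move=> sT tT fi fB.
apply: (le_trans (le_norm_oriented_integral sT tT fi (g := cst B) _ fB)).
  by apply: continuous_leb_integrable; exact: cst_continuous.
rewrite Rintegral_cst; last exact: itv_leb_measurable.
rewrite (_ : fine _ = `|t - s|)//.
have le : Num.min s t <= Num.max s t by rewrite le_max ge_min lexx.
have -> : forall X, fine (Measure.sort mu X) = fine (mu X) by [].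
rewrite leb_itv_cc//= .
by case: (leP s t) => st; [rewrite ger0_norm// subr_ge0|rewrite distrC gtr0_norm// subr_gt0].
Qed.

(** Integrating the weight exp(c |x - s|) away from s gains a factor 1/c, in both time
    directions. *)
Lemma leb_integral_expR_dist (c s t : R) : 0 < c ->
  \int[mu]_(x in `[Num.min s t, Num.max s t]) expR (c * `|x - s|) <=
  c^-1 * expR (c * `|t - s|).
Proof.
move=> c0; case: (leP s t) => st.
- under eq_Rintegral => x.
    rewrite inE/= in_itv/= => /andP[sx _]. rewrite ger0_norm ?subr_ge0// mulrBr. over.
  rewrite leb_integral_expR ?gt_eqF// ger0_norm ?subr_ge0// mulrBr.
  by rewrite lerBlDr lerDl mulr_ge0 ?invr_ge0 ?(ltW c0) ?expR_ge0.
- under eq_Rintegral => x.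
    rewrite inE/= in_itv/= => /andP[_ xs].
    rewrite distrC ger0_norm ?subr_ge0// mulrBr addrC -mulNr. over.
  rewrite leb_integral_expR ?(ltW st)// ?oppr_eq0 ?gt_eqF// distrC gtr0_norm ?subr_gt0//.
  rewrite invrN !mulNr opprK addrC addNr expR0 mulrBr [c * s - _]addrC.
  by rewrite gerBl mulr1 invr_ge0 ltW.
Qed.

Lemma continuous_expR_dist (c s : R) : continuous (fun x => expR (c * `|x - s|)).
Proof.
move=> x; apply: continuous_comp; last exact: continuous_expR.
apply: cvgMr; apply: cvg_norm; apply: cvgB; [exact: cvg_id|exact: cvg_cst].
Qed.

(** With c = 2 L and K = L M the first term is M / 2 times the weight. This halving drives both the
    Gronwall estimate and the contraction of the Picard iteration. *)
Lemma norm_oriented_integral_le_expR (T c K : R) (f e : R -> R) (s t : R) :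
  0 < c -> 0 <= K -> 0 <= s <= T -> 0 <= t <= T ->
  mu.-integrable `[0, T] (EFin \o f) -> mu.-integrable `[0, T] (EFin \o e) ->
  (forall x, 0 <= e x) ->
  (forall x, 0 <= x <= T -> `|f x| <= K * expR (c * `|x - s|) + e x) ->
  `|oriented_integral s t f| <=
  K * (c^-1 * expR (c * `|t - s|)) + \int[mu]_(x in `[0, T]) e x.
Proof.
move=> c0 K0 sT tT fi ei e0 fle.
have wi a b : mu.-integrable `[a, b] (EFin \o (fun x => expR (c * `|x - s|))).
  by apply: continuous_leb_integrable; exact: continuous_expR_dist.
have kwi a b : mu.-integrable `[a, b] (EFin \o (fun x => K * expR (c * `|x - s|))).
  apply: continuous_leb_integrable => x; apply: cvgMr; exact: continuous_expR_dist.
have kei : mu.-integrable `[0, T] (EFin \o (fun x => K * expR (c * `|x - s|) + e x)).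
  exact: (integrableD (itv_leb_measurable _) (kwi 0 T) ei).
apply: (le_trans (le_norm_oriented_integral sT tT fi kei fle)).
move: (sT) (tT) => /andP[s0 sT'] /andP[t0 tT'].
have m0 : 0 <= Num.min s t by rewrite le_min s0 t0.
have MT : Num.max s t <= T by rewrite ge_max sT' tT'.
rewrite RintegralD//; [|exact: itv_leb_measurable|exact: leb_integrableS ei].
rewrite lerD//.
  rewrite RintegralZl//; last exact: itv_leb_measurable.
  by rewrite ler_wpM2l//; exact: leb_integral_expR_dist.
apply: fine_le.
- by apply: integrable_fin_num; [exact: itv_leb_measurable|exact: leb_integrableS ei].
- by apply: integrable_fin_num; [exact: itv_leb_measurable|].
- apply: ge0_subset_integral; do ?exact: itv_leb_measurable.
  + exact: measurable_int ei.
  + by move=> x _; rewrite lee_fin.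
  + move=> x /=; rewrite !in_itv/= => /andP[mx xM].
    by rewrite (le_trans m0 mx) (le_trans xM MT).
Qed.
End oriented_integral.

(** * Gronwall estimate *)

Section vector_integral.
Variable R : realType.
Notation mu := (@completed_lebesgue_measure R).

(** The norm of row vectors is the max norm, so coordinatewise bounds carry over to vectors without
    a factor depending on the dimension. *)
Lemma rV_norm_le n (x : 'rV[R]_n) (r : R) :
  0 <= r -> (forall i, `|x ord0 i| <= r) -> `|x| <= r.
Proof.
move=> r0 xr; rewrite [`|x|]mx_normrE; apply/bigmax_leP; split => // -[i j] _ /=.
by rewrite ord1.
Qed.

Lemma coord_norm_le n (x : 'rV[R]_n) i : `|x ord0 i| <= `|x|.
Proof.
rewrite [`|x|]mx_normrE.
by apply/bigmax_geP; right; exists (ord0, i).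
Qed.

Definition oint n (s t : R) (f : R -> 'rV[R]_n) : 'rV[R]_n :=
  \row_i oriented_integral s t (fun tau => f tau ord0 i).

Definition vint n (T : R) (f : R -> 'rV[R]_n) : Prop :=
  forall i, mu.-integrable `[0, T] (fun tau => (f tau ord0 i)%:E).

Variables (n : nat) (T : R).
Hypothesis T0 : 0 < T.
Implicit Types (f g y : R -> 'rV[R]_n) (s t : R).

Lemma solves_odeP (w : R -> 'rV[R]_n -> 'rV[R]_n) s x y :
  solves_ode T w s x y <-> vint T (fun tau => w tau (y tau)) /\
  forall t, 0 <= t <= T -> y t = x + oint s t (fun tau => w tau (y tau)).
Proof.
split=> [sol|[fi ye] i]; last first.
  by split=> [|t tT]; [exact: fi|rewrite {1}ye// !mxE].
split=> [i|t tT]; first by have [] := sol i.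
by apply/rowP => i; rewrite !mxE; have [_ ->] := sol i.
Qed.

Lemma ointB s t f g : 0 <= s <= T -> 0 <= t <= T -> vint T f -> vint T g ->
  oint s t f - oint s t g = oint s t (fun tau => f tau - g tau).
Proof.
move=> sT tT fi gi; apply/rowP => i; rewrite !mxE.
have fgi : mu.-integrable `[0, T] (EFin \o (fun tau => (f tau - g tau) ord0 i)).
  have := integrableB (itv_leb_measurable _) (fi i) (gi i).
  by apply: eq_integrable; [exact: itv_leb_measurable|move=> x _ /=; rewrite !mxE].
rewrite !(oriented_integralE sT tT)//; do ?[exact: fi|exact: gi].
have E a : 0 <= a <= T -> \int[mu]_(x in `[0, a]) ((f x - g x) ord0 i) =
   \int[mu]_(x in `[0, a]) (f x ord0 i) - \int[mu]_(x in `[0, a]) (g x ord0 i).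
  move=> /andP[a0 aT]; rewrite -RintegralB; last 3 first.
  - exact: itv_leb_measurable.
  - exact: leb_integrableS (fi i).
  - exact: leb_integrableS (gi i).
  by apply: eq_Rintegral => x _; rewrite !mxE.
rewrite !E//; ring.
Qed.

Lemma norm_oint_le_expR (c K : R) f (e : R -> R) s t :
  0 < c -> 0 <= K -> 0 <= s <= T -> 0 <= t <= T ->
  vint T f -> mu.-integrable `[0, T] (EFin \o e) -> (forall x, 0 <= e x) ->
  (forall x, 0 <= x <= T -> `|f x| <= K * expR (c * `|x - s|) + e x) ->
  `|oint s t f| <= K * (c^-1 * expR (c * `|t - s|)) + \int[mu]_(x in `[0, T]) e x.
Proof.
move=> c0 K0 sT tT fi ei e0 fle; apply: rV_norm_le.
  rewrite addr_ge0//; last exact: Rintegral_ge0.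
  by rewrite !mulr_ge0 ?invr_ge0 ?(ltW c0) ?expR_ge0.
move=> i; rewrite mxE; apply: norm_oriented_integral_le_expR => //; first exact: fi.
by move=> x xT; apply: le_trans (fle _ xT); exact: coord_norm_le.
Qed.

Lemma norm_oint_le_cst (B : R) f s t : 0 <= B ->
  0 <= s <= T -> 0 <= t <= T -> vint T f ->
  (forall x, 0 <= x <= T -> `|f x| <= B) -> `|oint s t f| <= B * `|t - s|.
Proof.
move=> B0 sT tT fi fB; apply: rV_norm_le; first exact: mulr_ge0.
move=> i; rewrite mxE; apply: norm_oriented_integral_le_cst sT tT (fi i) _.
by move=> x xT; apply: le_trans (fB _ xT); exact: coord_norm_le.
Qed.

Lemma oint_bounded f s : 0 <= s <= T -> vint T f ->
  exists B, forall t, 0 <= t <= T -> `|oint s t f| <= B.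
Proof.
move=> sT fi.
pose b i : R := \int[mu]_(x in `[0, T]) `|f x ord0 i|.
have b0 i : 0 <= b i by exact: Rintegral_ge0.
exists (\sum_i b i) => t tT; apply: rV_norm_le; first exact: sumr_ge0.
move=> i; rewrite mxE (bigD1 i)//=; apply: ler_wpDr; first exact: sumr_ge0.
(* With K = 0 the exponential term vanishes and only the L^1 bound with e = |f| remains. *)
have := @norm_oriented_integral_le_expR R T 1 0 (fun x => f x ord0 i)
  (fun x => `|f x ord0 i|) s t ltr01 (lexx _) sT tT (fi i).
rewrite mul0r add0r; apply => //.
  exact: (integrable_norm (fi i)).
by move=> x _; rewrite mul0r add0r.
Qed.

(* The integral term is absorbed in the weighted norm sup_t |d t| exp(-2 L |t - s|). *)
Lemma integral_stability (L s : R) (x x' : 'rV[R]_n) y y' f f' (e : R -> R) :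
  0 < L -> 0 <= s <= T -> vint T f -> vint T f' ->
  mu.-integrable `[0, T] (EFin \o e) -> (forall tau, 0 <= e tau) ->
  (forall t, 0 <= t <= T -> y t = x + oint s t f) ->
  (forall t, 0 <= t <= T -> y' t = x' + oint s t f') ->
  (forall t, 0 <= t <= T -> `|f t - f' t| <= L * `|y t - y' t| + e t) ->
  forall t, 0 <= t <= T -> `|y t - y' t| <=
    2 * (`|x - x'| + \int[mu]_(tau in `[0, T]) e tau) * expR (2 * L * T).
Proof.
move=> L0 sT fi f'i ei e0 ye y'e ff'.
set E := \int[mu]_(tau in _) _; have E0 : 0 <= E by exact: Rintegral_ge0.
pose d t := `|y t - y' t|; pose W t := expR (2 * L * `|t - s|).
have W0 t : 0 < W t by exact: expR_gt0.
have W1 t : 1 <= W t by rewrite -expR0 ler_expR !mulr_ge0// ltW.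
have L2 : 0 < 2 * L by exact: mulr_gt0.
have ffi : vint T (fun tau => f tau - f' tau).
  move=> i; have := integrableB (itv_leb_measurable _) (fi i) (f'i i).
  by apply: eq_integrable; [exact: itv_leb_measurable|move=> z _ /=; rewrite !mxE].
have de t : 0 <= t <= T -> d t <= `|x - x'| + `|oint s t (fun tau => f tau - f' tau)|.
  move=> tT; rewrite /d ye// y'e// opprD addrACA ointB//; exact: ler_normD.
(* The weighted supremum M must be known to be finite before half of it can be absorbed. *)
have [B HB] := oint_bounded sT ffi.
pose S := [set d t / W t | t in [set t | 0 <= t <= T]].
have TT : 0 <= T <= T by rewrite lexx ltW.
have S0 : S !=set0 by exists (d T / W T); exists T.
have Sub : has_ubound S.
  exists (`|x - x'| + B) => _ [t tT <-].
  rewrite ler_pdivrMr//; apply: (le_trans (de _ tT)).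
  have dB : `|x - x'| + `|oint s t (fun tau => f tau - f' tau)| <= `|x - x'| + B.
    by rewrite lerD2l HB.
  apply: (le_trans dB); rewrite ler_peMr//; apply: le_trans dB; exact: addr_ge0.
pose M := sup S.
have dM t : 0 <= t <= T -> d t <= M * W t.
  by move=> tT; rewrite -ler_pdivrMr//; apply: ub_le_sup => //; exists t.
have M0 : 0 <= M.
  have ST : S (d T / W T) by exists T.
  by apply: le_trans (ub_le_sup Sub ST); rewrite divr_ge0 ?(ltW (W0 T)) ?normr_ge0.
have step t : 0 <= t <= T -> d t <= (`|x - x'| + E + M / 2) * W t.
  move=> tT; apply: (le_trans (de _ tT)).
  have := @norm_oint_le_expR (2 * L) (L * M) (fun tau => f tau - f' tau) e s t L2
    (mulr_ge0 (ltW L0) M0) sT tT ffi ei e0.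
  move=> /(_ _)/le_trans H.
  rewrite -lerBrDl; apply: H.
    move=> z zT; apply: (le_trans (ff' _ zT)); rewrite lerD2r -mulrA ler_wpM2l ?(ltW L0)//.
    exact: dM.
  have -> : L * M * ((2 * L)^-1 * expR (2 * L * `|t - s|)) = M / 2 * W t.
    by rewrite /W; field; rewrite gt_eqF.
  rewrite -/E -/(W t); have := W1 t; move: (W t) => z z1.
  have : 0 <= `|x - x'| by []. move: (`|x - x'|) => a a0; nra.
(* Hence M <= 2 (|x - x'| + E): this is the factor 2 of the conclusion. *)
have M2 : M <= `|x - x'| + E + M / 2.
  by apply: ge_sup => // _ [t tT <-]; rewrite ler_pdivrMr//; exact: step.
move=> t tT; apply: (le_trans (dM _ tT)); apply: ler_pM => //.
- exact/ltW.
- by move: M2; lra.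
- rewrite /W ler_expR ler_pM2l//.
  move: sT tT => /andP[? ?] /andP[? ?]; rewrite ler_norml; lra.
Qed.
End vector_integral.

(** * Caratheodory differential equations *)

Section picard_iteration.
Variable R : realType.
Notation mu := (@completed_lebesgue_measure R).

Lemma cvg_half_pow (c : R) : (fun k => c / 2 ^+ k) @ \oo --> 0.
Proof.
have := @cvg_geometric R c 2^-1; rewrite ger0_norm// invf_lt1// ltr1n => /(_ isT).
rewrite (_ : geometric _ _ = fun k => c / 2 ^+ k)//.
by apply/funext => k; rewrite /= exprVn.
Qed.

Lemma le_half_pow (a c : R) : (forall k, a <= c / 2 ^+ k) -> a <= 0.
Proof.
by move=> ac; apply: cvgr_to_ge (cvg_half_pow c) _; exact: nearW.
Qed.

Lemma half_pow_cauchy (a : nat -> R) (c : R) :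
  (forall k m, `|a (k + m)%N - a k| <= c / 2 ^+ k) ->
  forall k, a @ \oo --> lim (a @ \oo) /\ `|lim (a @ \oo) - a k| <= c / 2 ^+ k.
Proof.
move=> ac.
have ca : cvg (a @ \oo).
  apply: cauchy_cvg; apply: cauchy_exP => e e0.
  have /cvgrPdist_lt/(_ _ e0)[k _ /(_ k (leqnn k))] := cvg_half_pow c.
  rewrite sub0r normrN => ke; exists (a k); exists k => // j /= kj.
  rewrite -ball_normE/= distrC -(subnKC kj); apply: le_lt_trans (ac _ _) _.
  by apply: le_lt_trans ke; exact: ler_norm.
move=> k; split => //.
have cn : (fun m => `|a m - a k|) @ \oo --> `|lim (a @ \oo) - a k|.
  by apply: cvg_norm; apply: cvgB => //; exact: cvg_cst.
apply: cvgr_to_le cn _; exists k => // j /= kj.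
by rewrite -(subnKC kj).
Qed.

Lemma lipschitz_leb_measurable (T B : R) (h : R -> R) : 0 <= T ->
  (forall t t', 0 <= t <= T -> 0 <= t' <= T -> `|h t - h t'| <= B * `|t - t'|) ->
  measurable_fun (`[0, T] : set (leb_time R)) (h : _ -> measurableTypeR R).
Proof.
move=> T0 hB.
(* Clamping time to [0, T] extends h to a function continuous on the whole line. *)
pose c t := Num.max 0 (Num.min t T).
have cT t : 0 <= c t <= T by rewrite /c le_max lexx/= ge_max T0 ge_min lexx orbT.
have cc t t' : `|c t - c t'| <= `|t - t'|.
  have mxB (a b d : R) : `|Num.max a b - Num.max a d| <= `|b - d|.
    by case: (leP a b) => ?; case: (leP a d) => ?; rewrite ler_norml;
      move: (ler_norm (b - d)) (ler_norm (d - b)); rewrite (distrC d b); lra.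
  have mnB (a b d : R) : `|Num.min b a - Num.min d a| <= `|b - d|.
    by case: (leP b a) => ?; case: (leP d a) => ?; rewrite ler_norml;
      move: (ler_norm (b - d)) (ler_norm (d - b)); rewrite (distrC d b); lra.
  exact: le_trans (mxB _ _ _) (mnB _ _ _).
have chc : continuous (h \o c).
  move=> t; apply/cvgrPdist_lt => e e0; near=> t'.
  rewrite /=; apply: le_lt_trans (hB _ _ (cT _) (cT _)) _.
  apply: (@le_lt_trans _ _ (`|B| * `|t - t'|)).
    by rewrite (le_trans (ler_norm _))// normrM normr_id ler_wpM2l.
  (* B carries no sign assumption; |B| + 1 is positive and can be divided by. *)
  apply: (@le_lt_trans _ _ ((`|B| + 1) * `|t - t'|)); first by rewrite ler_wpM2r// lerDl.
  rewrite mulrC -ltr_pdivlMr; last by rewrite ltr_wpDl.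
  near: t'; have /cvgrPdist_lt := @cvg_id _ (nbhs t); apply.
  by rewrite divr_gt0// ltr_wpDl.
have hE : {in [set` `[0, T]], h \o c =1 h}.
  move=> t; rewrite inE/= in_itv/= => /andP[t0 tT].
  by rewrite /c (min_idPl tT) (max_idPr t0).
apply: (@eq_measurable_fun _ _ (leb_time R) (measurableTypeR R) _ _ _ hE).
apply: borel_leb_measurable_fun => //; apply: measurable_funTS.
exact: continuous_measurable_fun.
Unshelve. all: by end_near. Qed.

Variables (n : nat) (T : R).
Hypothesis T0 : 0 < T.
Implicit Types (f g y : R -> 'rV[R]_n) (s t : R).

Lemma rV_measurable_vint f B : rV_measurable_fun `[0, T] f ->
  (forall t, 0 <= t <= T -> `|f t| <= B) -> vint T f.
Proof.
move=> mf fB i; apply: measurable_bounded_integrable.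
- exact: itv_leb_measurable.
- exact: leb_itv_lty.
- exact: mf.
- exists B; split; first exact: num_real.
  move=> r Br t/=; rewrite in_itv/= => tT.
  by rewrite (le_trans (coord_norm_le _ _))// (le_trans (fB _ tT))// ltW.
Qed.

(** A bounded integrand has a Lipschitz primitive. *)
Lemma oint_measurable f B s (x : 'rV[R]_n) : 0 <= s <= T -> vint T f ->
  (forall t, 0 <= t <= T -> `|f t| <= B) ->
  rV_measurable_fun `[0, T] (fun t => x + oint s t f).
Proof.
move=> sT fi fB i; apply: (@lipschitz_leb_measurable _ B) => [|t t' tT t'T]; first exact: ltW.
rewrite !mxE opprD addrACA subrr add0r.
have := @norm_oriented_integral_le_cst _ T B _ t' t t'T tT (fi i) _.
rewrite !(@oriented_integralE _ T)//; do ?exact: (fi i).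
rewrite opprB addrA subrK; apply => z zT.
by rewrite (le_trans (coord_norm_le _ _))// fB.
Qed.

(** The last clause states measurability of superpositions directly. In this form it can be iterated
    in the Picard scheme, and it passes to the linearised field through difference quotients. *)
Definition caratheodory_field (w : R -> 'rV[R]_n -> 'rV[R]_n) (L C : R) : Prop :=
  [/\ forall t x x', 0 <= t <= T -> `|w t x - w t x'| <= L * `|x - x'|,
      forall t, 0 <= t <= T -> `|w t 0| <= C &
      forall y, rV_measurable_fun `[0, T] y ->
        rV_measurable_fun `[0, T] (fun t => w t (y t))].

Section picard.
Variables (w : R -> 'rV[R]_n -> 'rV[R]_n) (L C s : R) (x : 'rV[R]_n).
Hypotheses (L0 : 0 < L) (wP : caratheodory_field w L C) (sT : 0 <= s <= T).

Lemma field_growth t z : 0 <= t <= T -> `|w t z| <= C + L * `|z|.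
Proof.
move=> tT; have [/(_ t z 0 tT)] := wP; rewrite subr0 => H /(_ t tT) wC _.
have := ler_normD (w t z - w t 0) (w t 0); rewrite subrK; lra.
Qed.

Lemma field_vint y B : rV_measurable_fun `[0, T] y ->
  (forall t, 0 <= t <= T -> `|y t| <= B) -> vint T (fun t => w t (y t)).
Proof.
move=> my yB; apply: (@rV_measurable_vint _ (C + L * B)).
  by have [_ _] := wP; exact.
move=> t tT; apply: le_trans (field_growth _ tT) _.
by rewrite lerD2l ler_wpM2l ?yB// ltW.
Qed.

Fixpoint picard k : R -> 'rV[R]_n :=
  if k is k'.+1 then fun t => x + oint s t (fun tau => w tau (picard k' tau))
  else fun=> x.

Lemma picard_measurable_bounded k : rV_measurable_fun `[0, T] (picard k) /\
  exists B, forall t, 0 <= t <= T -> `|picard k t| <= B.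
Proof.
elim: k => [|k [mk [B kB]]] /=.
  by split; [move=> i; exact: measurable_cst|exists `|x|].
have fi := field_vint mk kB.
have fB t : 0 <= t <= T -> `|w t (picard k t)| <= C + L * B.
  move=> tT; apply: le_trans (field_growth _ tT) _.
  by rewrite lerD2l ler_wpM2l ?kB// ltW.
split; first exact: oint_measurable fi fB.
have [B' HB'] := oint_bounded sT fi.
by exists (`|x| + B') => t tT; rewrite (le_trans (ler_normD _ _))// lerD2l HB'.
Qed.

Let W t := expR (2 * L * `|t - s|).
Let D := (C + L * `|x|) * T.

Lemma picard_vint k : vint T (fun t => w t (picard k t)).
Proof. by have [mk [B kB]] := picard_measurable_bounded k; exact: field_vint mk kB. Qed.

(** In the weight W the Picard operator contracts by 1/2; D bounds the first increment, since the
    field along the constant curve x is at most C + L |x| during a time at most T. *)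
Lemma picard_step k t : 0 <= t <= T ->
  `|picard k.+1 t - picard k t| <= D / 2 ^+ k * W t.
Proof.
(* The sign is read off the growth bound at time s, where C + L |x| dominates a norm. *)
have CL : 0 <= C + L * `|x| by apply: le_trans (field_growth x sT).
have D0 : 0 <= D by rewrite mulr_ge0// ltW.
have ts t0 : 0 <= t0 <= T -> `|t0 - s| <= T.
  by move: sT => /andP[? ?] /andP[? ?]; rewrite ler_norml; lra.
elim: k t => [|k IH] t tT /=.
  rewrite addrAC subrr add0r expr0 divr1.
  apply: (@le_trans _ _ D); last first.
    by rewrite ler_peMr// -expR0 ler_expR !mulr_ge0// ltW.
  apply: le_trans (norm_oint_le_cst CL sT tT (picard_vint 0) _) _.
    by move=> z zT; exact: field_growth.
  by rewrite ler_wpM2l// ts.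
rewrite opprD addrACA subrr add0r (ointB sT tT (picard_vint k.+1) (picard_vint k)).
have L2 : 0 < 2 * L by rewrite mulr_gt0.
have K0 : 0 <= L * (D / 2 ^+ k) by rewrite mulr_ge0 ?(ltW L0)// divr_ge0// exprn_ge0.
have := @norm_oint_le_expR _ n T (2 * L) (L * (D / 2 ^+ k))
  (fun tau => w tau (picard k.+1 tau) - w tau (picard k tau)) (cst 0) s t L2 K0 sT tT.
move=> /(_ _ _ _ _)/le_trans; apply.
- move=> i; have := integrableB (itv_leb_measurable _) (picard_vint k.+1 i) (picard_vint k i).
  by apply: eq_integrable; [exact: itv_leb_measurable|move=> z _ /=; rewrite !mxE].
- by apply: continuous_leb_integrable; exact: cst_continuous.
- by [].
- move=> z zT; rewrite addr0 -mulrA; have [wL _ _] := wP.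
  by apply: (le_trans (wL _ _ _ zT)); rewrite ler_wpM2l ?(ltW L0)//; exact: IH.
rewrite Rintegral_cst; last exact: itv_leb_measurable.
rewrite mul0r addr0 le_eqVlt; apply/orP; left; apply/eqP.
by rewrite /W exprS; field; rewrite expf_neq0 ?(gt_eqF L0).
Qed.

Lemma picard_cauchy t k m : 0 <= t <= T ->
  `|picard (k + m) t - picard k t| <= 2 * D * expR (2 * L * T) / 2 ^+ k.
Proof.
move=> tT; have CL : 0 <= C + L * `|x| by apply: le_trans (field_growth x sT).
have D0 : 0 <= D by rewrite mulr_ge0// ltW.
set E := expR _; have E0 : 0 <= E by exact: expR_ge0.
have p0 j : (0 : R) < 2 ^+ j by rewrite exprn_gt0.
(* Subtracting the remaining geometric tail makes the bound telescope, so that induction on m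
   closes. *)
suff H : `|picard (k + m) t - picard k t| <= 2 * D * E / 2 ^+ k - 2 * D * E / 2 ^+ (k + m).
  apply: (le_trans H); rewrite gerBl; apply: divr_ge0; last exact/ltW.
  by rewrite mulr_ge0// mulr_ge0.
elim: m => [|m IH]; first by rewrite addn0 !subrr normr0.
rewrite addnS; apply: le_trans (ler_distD (picard (k + m) t) _ _) _.
have := picard_step (k + m) tT.
have WE : W t <= E.
  rewrite /W /E ler_expR ler_pM2l ?mulr_gt0//.
  by move: sT tT => /andP[? ?] /andP[? ?]; rewrite ler_norml; lra.
have : D / 2 ^+ (k + m) * W t <= D / 2 ^+ (k + m) * E.
  by rewrite ler_wpM2l// divr_ge0// ltW.
have -> : 2 * D * E / 2 ^+ (k + m).+1 = D / 2 ^+ (k + m) * E.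
  by rewrite exprS; field; rewrite gt_eqF.
move: IH; have -> : 2 * D * E / 2 ^+ (k + m) = 2 * (D / 2 ^+ (k + m) * E).
  by field; rewrite gt_eqF.
by lra.
Qed.

End picard.
End picard_iteration.

Section caratheodory_ode.
Variable R : realType.
Notation mu := (@completed_lebesgue_measure R).
Variables (n : nat) (T : R).
Hypothesis T0 : 0 < T.
Implicit Types (f g y : R -> 'rV[R]_n) (s t : R).

Lemma eq_rV_measurable_fun m (f g : R -> 'rV[R]_m) :
  (forall t, 0 <= t <= T -> f t = g t) ->
  rV_measurable_fun `[0, T] f -> rV_measurable_fun `[0, T] g.
Proof.
move=> fg mf i.
have hE : {in [set` `[0, T]], (fun t => f t ord0 i) =1 (fun t => g t ord0 i)}.
  by move=> t; rewrite inE/= in_itv/= => tT; rewrite fg.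
exact: (@eq_measurable_fun _ _ (leb_time R) (measurableTypeR R) _ _ _ hE (mf i)).
Qed.

(** Measurability belongs to the conclusion because [flow] selects an arbitrary solution: by
    uniqueness the selected one agrees with y on [0, T] and inherits it. *)
Theorem caratheodory_exists (w : R -> 'rV[R]_n -> 'rV[R]_n) (L C s : R) (x : 'rV[R]_n) :
  0 < L -> caratheodory_field T w L C -> 0 <= s <= T ->
  exists y, [/\ solves_ode T w s x y, rV_measurable_fun `[0, T] y &
    exists B, forall t, 0 <= t <= T -> `|y t| <= B].
Proof.
move=> L0 wP sT.
set p := picard w s x.
pose c := 2 * ((C + L * `|x|) * T) * expR (2 * L * T).
have pc t k m : 0 <= t <= T -> `|p (k + m)%N t - p k t| <= c / 2 ^+ k.
  exact: (picard_cauchy T0 x L0 wP sT).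
pose y t : 'rV[R]_n := \row_i lim (p k t ord0 i @[k --> \oo]).
have py t i k : 0 <= t <= T ->
    p k t ord0 i @[k --> \oo] --> y t ord0 i /\ `|y t ord0 i - p k t ord0 i| <= c / 2 ^+ k.
  move=> tT; rewrite mxE; apply: (@half_pow_cauchy _ (fun k => p k t ord0 i)) => {}k m.
  apply: le_trans (pc t k m tT); have := @coord_norm_le _ _ (p (k + m)%N t - p k t) i.
  by rewrite !mxE.
have c0 k : 0 <= c / 2 ^+ k.
  by apply: le_trans (pc s k 0 sT).
have yp t k : 0 <= t <= T -> `|y t - p k t| <= c / 2 ^+ k.
  move=> tT; apply: rV_norm_le => // i.
  by have [_] := py t i k tT; rewrite !mxE.
have my : rV_measurable_fun `[0, T] y.
  move=> i.
  apply: (@measurable_fun_cvg _ (leb_time R) R _ (fun k t => p k t ord0 i)).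
    by move=> k; have [pm _] := picard_measurable_bounded T0 x L0 wP sT k; exact: (pm i).
  by move=> t /=; rewrite in_itv/= => tT; have [] := py t i 0%N tT.
have yB t : 0 <= t <= T -> `|y t| <= `|x| + c.
  move=> tT; have := yp t 0%N tT; rewrite expr0 divr1 /=.
  by have := ler_normD (y t - x) x; rewrite subrK; lra.
have yi := field_vint L0 wP my yB.
exists y; split => //; last by exists (`|x| + c).
apply/solves_odeP; split => // t tT.
apply/eqP; rewrite -subr_eq0 -normr_le0; apply/eqP.
set z := _ - _; apply/eqP.
(* The defect of y splits into y - p_(k+1), at most c / 2^k, and an integral of w(p_k) - w(y), at
   most L (c / 2^k) T. *)
apply: (@le_half_pow _ _ (c + L * c * T)) => k.
have -> : z = (y t - p k.+1 t) + (oint s t (fun tau => w tau (p k tau)) -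
    oint s t (fun tau => w tau (y tau))).
  by rewrite /z /p /= -/p !opprD !addrA subrK.
have pi := picard_vint T0 x L0 wP sT k.
apply: (le_trans (ler_normD _ _)).
rewrite mulrDl lerD//.
  apply: (le_trans (yp t k.+1 tT)); have := c0 k.
  have -> : c / 2 ^+ k.+1 = c / 2 ^+ k / 2 by rewrite exprS; field; rewrite expf_neq0.
  by move: (c / 2 ^+ k) => a; lra.
rewrite (ointB sT tT pi yi).
have d0 : 0 <= L * (c / 2 ^+ k) by rewrite mulr_ge0// ltW.
have dvi : vint T (fun tau => w tau (p k tau) - w tau (y tau)).
  move=> i; have := integrableB (itv_leb_measurable _) (pi i) (yi i).
  by apply: eq_integrable; [exact: itv_leb_measurable|move=> u _ /=; rewrite !mxE].
apply: le_trans (norm_oint_le_cst d0 sT tT dvi _) _.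
  move=> u uT; have [wL _ _] := wP; apply: (le_trans (wL _ _ _ uT)).
  by rewrite ler_wpM2l ?(ltW L0)// distrC yp.
have -> : L * c * T / 2 ^+ k = L * (c / 2 ^+ k) * T by field; rewrite expf_neq0.
rewrite ler_wpM2l//.
by move: sT tT => /andP[? ?] /andP[? ?]; rewrite ler_norml; lra.
Qed.

(** The Lipschitz condition falls on w and the defect is measured along y'. Later y' is a known
    curve (a limit trajectory, a constant, a linearised solution) while w may run through a sequence
    of fields. *)
Lemma ode_stability (w w' : R -> 'rV[R]_n -> 'rV[R]_n) (L s : R) (x x' : 'rV[R]_n)
    y y' (e : R -> R) :
  0 < L -> 0 <= s <= T ->
  (forall t x x', 0 <= t <= T -> `|w t x - w t x'| <= L * `|x - x'|) ->
  solves_ode T w s x y -> solves_ode T w' s x' y' ->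
  mu.-integrable `[0, T] (EFin \o e) -> (forall t, 0 <= e t) ->
  (forall t, 0 <= t <= T -> `|w t (y' t) - w' t (y' t)| <= e t) ->
  forall t, 0 <= t <= T -> `|y t - y' t| <=
    2 * (`|x - x'| + \int[mu]_(tau in `[0, T]) e tau) * expR (2 * L * T).
Proof.
move=> L0 sT wL /solves_odeP[yi ye] /solves_odeP[y'i y'e] ei e0 we.
apply: (integral_stability T0 L0 sT yi y'i ei e0 ye y'e) => t tT.
apply: le_trans (ler_distD (w t (y' t)) _ _) _.
exact: lerD (wL _ _ _ tT) (we _ tT).
Qed.

Section flow.
Variables (w : R -> 'rV[R]_n -> 'rV[R]_n) (L C s : R).
Hypotheses (L0 : 0 < L) (wP : caratheodory_field T w L C) (sT : 0 <= s <= T).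

Lemma ode_unique x y y' : solves_ode T w s x y -> solves_ode T w s x y' ->
  forall t, 0 <= t <= T -> y t = y' t.
Proof.
move=> yP y'P t tT; apply/eqP; rewrite -subr_eq0 -normr_le0.
have [wL _ _] := wP.
have := @ode_stability w w L s x x y y' (cst 0) L0 sT wL yP y'P.
move=> /(_ _ _ _ t tT)/le_trans; apply => //.
- by apply: continuous_leb_integrable; exact: cst_continuous.
- by move=> z _ /=; rewrite subrr normr0.
- rewrite subrr normr0 add0r Rintegral_cst; last exact: itv_leb_measurable.
  by rewrite mul0r mulr0 mul0r.
Qed.

Lemma flow_solves x : solves_ode T w s x (fun t => flow T w s t x).
Proof.
have [y [yP _ _]] := caratheodory_exists x L0 wP sT.
rewrite /flow; exact: (@xgetPex _ (fun=> x) [set y | solves_ode T w s x y] (ex_intro _ y yP)).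
Qed.

Lemma flow_unique x y t : solves_ode T w s x y -> 0 <= t <= T -> flow T w s t x = y t.
Proof. by move=> yP; exact: (ode_unique (flow_solves x) yP). Qed.

Lemma flow_measurable x : rV_measurable_fun `[0, T] (fun t => flow T w s t x).
Proof.
have [y [yP my _]] := caratheodory_exists x L0 wP sT.
by apply: eq_rV_measurable_fun my => t tT; rewrite (flow_unique yP).
Qed.

(** Comparison with the constant curve x, a solution for the zero field, along which w is at most C
    + L |x|. *)
Lemma flow_dist x t : 0 <= t <= T ->
  `|flow T w s t x - x| <= 2 * ((C + L * `|x|) * T) * expR (2 * L * T).
Proof.
move=> tT; have [wL _ _] := wP.
have z0 : solves_ode T (fun _ _ => 0) s x (fun=> x).
  move=> i; rewrite (_ : (0 : 'rV[R]_n) ord0 i = 0) ?mxE//.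
  have ci : mu.-integrable `[0, T] (EFin \o cst (0 : R)).
    by apply: continuous_leb_integrable; exact: cst_continuous.
  split => // u uT; rewrite (@oriented_integralE _ T)//.
  by rewrite !Rintegral_cst ?mul0r ?subr0 ?addr0//; exact: itv_leb_measurable.
have := @ode_stability w _ L s x x _ _ (cst (C + L * `|x|)) L0 sT wL (flow_solves x) z0.
move=> /(_ _ _ _ t tT)/le_trans; apply => //.
- by apply: continuous_leb_integrable; exact: cst_continuous.
- by move=> z; apply: le_trans (field_growth wP x sT).
- by move=> z zT /=; rewrite subr0; exact: (field_growth wP x zT).
- rewrite subrr normr0 add0r Rintegral_cst; last exact: itv_leb_measurable.
  have -> : forall X, fine (Measure.sort mu X) = fine (mu X) by [].
  by rewrite leb_itv_cc ?(ltW T0)//= subr0.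
Qed.

Lemma flow_lipschitz x x' t : 0 <= t <= T ->
  `|flow T w s t x - flow T w s t x'| <= 2 * expR (2 * L * T) * `|x - x'|.
Proof.
move=> tT; have [wL _ _] := wP.
have := @ode_stability w w L s x x' _ _ (cst 0) L0 sT wL (flow_solves x) (flow_solves x').
move=> /(_ _ _ _ t tT)/le_trans; apply => //.
- by apply: continuous_leb_integrable; exact: cst_continuous.
- by move=> z _ /=; rewrite subrr normr0.
- rewrite Rintegral_cst; last exact: itv_leb_measurable.
  by rewrite mul0r addr0 mulrAC.
Qed.

End flow.
End caratheodory_ode.

(** * Differentiability of the flow *)

(** If the claim fails near x, choosing a bad point within 1 / (k + 1) of x for each k gives a
    sequence contradicting the hypothesis. *)
Lemma near_seq (R : realType) (V : normedModType R) (x : V) (P : V -> Prop) :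
  (forall u : nat -> V, u @ \oo --> x -> exists k, P (u k)) ->
  \forall z \near x, P z.
Proof.
move=> H; apply: contrapT => nP.
have ex (k : nat) : exists z : V, `|x - z| < k.+1%:R^-1 /\ ~ P z.
  apply: contrapT => /forallNP nz; apply: nP.
  have : \forall z \near x, `|x - z| < k.+1%:R^-1.
    by have /cvgrPdist_lt := @cvg_id _ (nbhs x); apply; rewrite invr_gt0.
  by apply: filterS => z xz; apply: contrapT => nPz; apply: (nz z).
have [u uP] := choice ex.
have [|k Pk] := H u; last by have [] := uP k.
apply/cvgrPdist_lt => e e0; near=> k.
apply: lt_trans (uP k).1 _; near: k; exact: near_infty_natSinv_lt (PosNum e0).
Unshelve. all: by end_near. Qed.

(** The indices of the bad pairs only satisfy [k <= phi k]; they need not increase. The conclusion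
    has the shape that the near-covering form of compactness asks for. *)
Lemma near2_seq (R : realType) (V : normedModType R) (x : V) (P : nat -> V -> Prop) :
  (forall (u : nat -> V) (phi : nat -> nat), u @ \oo --> x ->
     (forall k, (k <= phi k)%N) -> exists k, P (phi k) (u k)) ->
  \forall z \near x & k \near \oo, P k z.
Proof.
move=> H; apply: contrapT => nP.
have ex (k : nat) : exists zj : V * nat,
    [/\ `|x - zj.1| < k.+1%:R^-1, (k <= zj.2)%N & ~ P zj.2 zj.1].
  apply: contrapT => /forallNP nz; apply: nP.
  exists (ball x k.+1%:R^-1, [set j | (k <= j)%N]) => /=.
    by split; [exact: nbhsx_ballx|exists k].
  move=> [z j] [/=]; rewrite -ball_normE/= => xz kj.
  by apply: contrapT => nPz; apply: (nz (z, j)); split.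
have [u uP] := choice ex.
have [||k Pk] := H (fun k => (u k).1) (fun k => (u k).2).
- apply/cvgrPdist_lt => e e0; near=> k.
  have [uk _ _] := uP k; apply: lt_trans uk _; near: k; exact: near_infty_natSinv_lt (PosNum e0).
- by move=> k; have [] := uP k.
- by have [] := uP k.
Unshelve. all: by end_near. Qed.

Section differential.
Variables (R : realType) (V W : normedModType R).

(** Quotients along the steps 1 / (k + 1) let Lipschitz bounds and measurability in time pass from a
    map to its differential. *)
Lemma diff_quotient_cvg (f : V -> W) (x v : V) : differentiable f x ->
  k.+1%:R *: (f (x + k.+1%:R^-1 *: v) - f x) @[k --> \oo] --> 'd f x v.
Proof.
move=> df; rewrite -deriveE//.
have /cvg_ex[l] : derivable f x v by exact: diff_derivable.
move=> fl; rewrite /derive (cvg_lim _ fl)//.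
have h0 : (fun k : nat => (k.+1%:R : R)^-1) @ \oo --> (0 : R)^'.
  move=> A A0.
  have H : \forall k \near \oo, (k.+1%:R : R)^-1 != 0 -> A (k.+1%:R)^-1.
    exact: (@cvg_harmonic R _ A0).
  by apply: filterS H => k; apply; rewrite invr_eq0 pnatr_eq0.
rewrite (_ : (fun k => _) = (fun h => h^-1 *: ((f \o shift x) (h *: v) - f x)) \o
  (fun k : nat => (k.+1%:R : R)^-1)).
  exact: cvg_comp h0 fl.
by apply/funext => k; rewrite /= invrK (addrC x).
Qed.

Lemma diff_norm_le (f : V -> W) (L : R) (x v : V) : differentiable f x ->
  (forall a b, `|f a - f b| <= L * `|a - b|) -> `|'d f x v| <= L * `|v|.
Proof.
move=> df fL.
apply: cvgr_to_le (cvg_norm (@diff_quotient_cvg f x v df)) _; near=> k.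
rewrite normrZ normr_nat -ler_pdivlMl//; apply: le_trans (fL _ _) _.
by rewrite addrAC subrr add0r normrZ gtr0_norm ?invr_gt0// mulrCA.
Unshelve. all: by end_near. Qed.
End differential.

Section vector_measurability.
Variable R : realType.
Notation mu := (@completed_lebesgue_measure R).
Variables (n : nat) (T : R).
Hypothesis T0 : 0 < T.
Implicit Types (f g y : R -> 'rV[R]_n) (s t : R).

Lemma rV_measurable_norm f (D : set R) : rV_measurable_fun D f ->
  measurable_fun (D : set (leb_time R)) (fun t => `|f t| : R).
Proof.
move=> mf; rewrite (_ : (fun t => _) = fun t => \big[Order.max/0]_ij `|f t ij.1 ij.2|); last first.
  by apply/funext => t; rewrite [LHS]mx_normrE.
elim: (index_enum _) => [|ij r IH].
  by under eq_fun do rewrite big_nil; exact: measurable_cst.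
under eq_fun do rewrite big_cons.
have mij : measurable_fun (D : set (leb_time R)) (fun t => `|f t ij.1 ij.2| : R).
  rewrite (ord1 ij.1); exact: (measurableT_comp (@normr_measurable R setT) (mf ij.2)).
exact: (measurable_maxr mij IH).
Qed.

Lemma leb_dominated_cvg0 (g : nat -> R -> R) (B : R) :
  (forall k, measurable_fun (`[0, T] : set (leb_time R)) (g k)) ->
  {ae mu, forall t, 0 <= t <= T -> g k t @[k --> \oo] --> 0} ->
  (forall k t, 0 <= t <= T -> `|g k t| <= B) ->
  \int[mu]_(t in `[0, T]) g k t @[k --> \oo] --> 0.
Proof.
move=> mg g0 gB.
have := @dominated_convergence _ _ _ mu `[0, T] (itv_leb_measurable _)
  (fun k t => (g k t)%:E) (cst 0%E) (cst B%:E).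
move=> [].
- by move=> k; apply/measurable_EFinP; exact: mg.
- exact: measurable_cst.
- have [N [mN N0 gN]] := g0; exists N; split => // t /= nt; apply: gN => /= gt.
  apply: nt; rewrite in_itv/= => tT.
  by apply/fine_cvgP; split; [exact: nearW|exact: gt].
- by apply: continuous_leb_integrable; exact: cst_continuous.
- exists set0; split; [exact: measurable0|exact: measure0|].
  by move=> t /= []; move=> k; rewrite in_itv/= => tT; rewrite lee_fin gB.
move=> _ _; rewrite integral0 => /fine_cvgP[_].
exact.
Qed.

End vector_measurability.

Lemma lipschitz_continuous (R : realType) (V W : normedModType R) (f : V -> W) (K : R) :
  0 < K -> (forall a b, `|f a - f b| <= K * `|a - b|) -> continuous f.
Proof.
move=> K0 fK a; apply/cvgrPdist_lt => e e0; near=> b.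
apply: le_lt_trans (fK _ _) _; rewrite mulrC -ltr_pdivlMr//; near: b.
by have /cvgrPdist_lt := @cvg_id _ (nbhs a); apply; exact: divr_gt0.
Unshelve. all: by end_near. Qed.

Lemma norm_le_cvg0 (R : realType) (V W : normedModType R) (u : nat -> V) (h : nat -> W) (K : R) :
  0 < K -> (forall k, `|u k| <= K * `|h k|) -> h @ \oo --> 0 -> u @ \oo --> 0.
Proof.
move=> K0 uh /cvgrPdist_lt h0; apply/cvgrPdist_lt => e e0.
apply: filterS (h0 _ (divr_gt0 e0 K0)) => k; rewrite !sub0r !normrN ltr_pdivlMr// mulrC.
exact: le_lt_trans.
Qed.

Section differential_sequences.
Variables (R : realType) (V W : normedModType R).

Lemma diff_remainder (f : V -> W) (x : V) : differentiable f x ->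
  forall e, 0 < e -> \forall z \near (0 : V), `|f (x + z) - f x - 'd f x z| <= e * `|z|.
Proof.
move=> df e e0; have [_ /eqaddoP/(_ e e0)] := (diff_locallyP x f).1 df.
by apply: filterS => z; rewrite !fctE /= (addrC z) opprD addrA.
Qed.

(** Sequential criterion for a given candidate differential. Increments may be taken nonzero, so
    that remainders can be divided by their norm; at a zero increment the remainder vanishes. *)
Lemma diff_seq (f : V -> W) (x : V) (df : {linear V -> W}) : continuous df ->
  (forall h : nat -> V, h @ \oo --> 0 -> (forall k, h k != 0) ->
   forall e, 0 < e -> exists k, `|f (x + h k) - f x - df (h k)| <= e * `|h k|) ->
  differentiable f x /\ 'd f x = df :> (V -> W).
Proof.
move=> dfc H.
have dfo : f \o shift x = cst (f x) + df +o_ 0 id.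
  apply/eqaddoP => e e0.
  suff : \forall z \near (0 : V), `|f (x + z) - f x - df z| <= e * `|z|.
    by apply: filterS => z; rewrite !fctE /= (addrC z) opprD addrA.
  apply: near_seq => h h0.
  have [[k hk]|/forallNP hN0] := pselect (exists k, h k = 0).
    by exists k; rewrite hk addr0 linear0 subr0 subrr normr0 mulr_ge0// ltW.
  by apply: H => // k; apply/eqP.
have E := diff_unique dfc dfo; split => //.
by apply/diff_locallyP; rewrite E.
Qed.
End differential_sequences.

Section variational_equation.
Variable R : realType.
Notation mu := (@completed_lebesgue_measure R).
Variables (n : nat) (T : R).
Hypothesis T0 : 0 < T.
Implicit Types (f g y : R -> 'rV[R]_n) (s t : R).

Lemma rV_measurableD (D : set R) f g : rV_measurable_fun D f -> rV_measurable_fun D g ->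
  rV_measurable_fun D (fun t => f t + g t).
Proof.
move=> mf mg i.
rewrite (_ : (fun t => _) = (fun t => f t ord0 i + g t ord0 i)).
  exact: measurable_funD (mf i) (mg i).
by apply/funext => t; rewrite mxE.
Qed.

Lemma rV_measurableZ (D : set R) (a : R) f : rV_measurable_fun D f ->
  rV_measurable_fun D (fun t => a *: f t).
Proof.
move=> mf i; rewrite (_ : (fun t => _) = (fun t => a * f t ord0 i)).
  exact: measurable_funM (measurable_cst _) (mf i).
by apply/funext => t; rewrite mxE.
Qed.

Lemma rV_measurableB (D : set R) f g : rV_measurable_fun D f -> rV_measurable_fun D g ->
  rV_measurable_fun D (fun t => f t - g t).
Proof.
move=> mf mg; rewrite (_ : (fun t => _) = fun t => f t + (-1) *: g t).
  exact: rV_measurableD mf (rV_measurableZ (-1) mg).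
by apply/funext => t; rewrite scaleN1r.
Qed.

Lemma vintZD a f g : vint T f -> vint T g -> vint T (fun t => a *: f t + g t).
Proof.
move=> fi gi i; have := integrableD (itv_leb_measurable _)
  (integrableZl (itv_leb_measurable _) a (fi i)) (gi i).
by apply: eq_integrable; [exact: itv_leb_measurable|move=> u _ /=; rewrite !mxE].
Qed.

Lemma ointZD a s t f g : 0 <= s <= T -> 0 <= t <= T -> vint T f -> vint T g ->
  oint s t (fun t => a *: f t + g t) = a *: oint s t f + oint s t g.
Proof.
move=> sT tT fi gi; apply/rowP => i; rewrite !mxE.
rewrite !(oriented_integralE sT tT)//; do ?[exact: fi|exact: gi]; last exact: (vintZD a fi gi i).
have E b : 0 <= b <= T -> \int[mu]_(x in `[0, b]) ((a *: f x + g x) ord0 i) =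
   a * \int[mu]_(x in `[0, b]) (f x ord0 i) + \int[mu]_(x in `[0, b]) (g x ord0 i).
  move=> /andP[b0 bT].
  have fib := leb_integrableS (lexx 0) bT (fi i).
  have gib := leb_integrableS (lexx 0) bT (gi i).
  rewrite -RintegralZl//; last exact: itv_leb_measurable.
  rewrite -RintegralD//; last 2 first.
  - exact: itv_leb_measurable.
  - exact: (integrableZl (itv_leb_measurable _) a fib).
  by apply: eq_Rintegral => x _; rewrite !mxE.
rewrite !E//; ring.
Qed.

(** A linear combination of solutions of a linear equation solves it, and solutions are unique. *)
Lemma flow_linear (A : R -> {linear 'rV[R]_n -> 'rV[R]_n}) (L C s t : R) :
  0 < L -> caratheodory_field T (fun t => A t) L C -> 0 <= s <= T -> 0 <= t <= T ->
  linear (flow T (fun t => A t) s t).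
Proof.
move=> L0 AP sT tT a h h'.
apply: (@flow_unique _ _ _ T0 _ L C s L0 AP sT _
  (fun t => a *: flow T (fun t => A t) s t h + flow T (fun t => A t) s t h')) => //.
have /solves_odeP[hi he] := flow_solves T0 L0 AP sT h.
have /solves_odeP[h'i h'e] := flow_solves T0 L0 AP sT h'.
apply/solves_odeP.
have E : (fun tau => A tau (a *: flow T (fun t => A t) s tau h + flow T (fun t => A t) s tau h')) =
  (fun tau => a *: A tau (flow T (fun t => A t) s tau h) + A tau (flow T (fun t => A t) s tau h')).
  by apply/funext => tau; rewrite linearP.
rewrite E; split; first exact: vintZD.
move=> u uT; rewrite ointZD// {1}he// {1}h'e// scalerDr !addrA; congr (_ + _).
by rewrite -!addrA; congr (_ + _); rewrite addrC.
Qed.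

Section differentiability.
Variables (w : R -> 'rV[R]_n -> 'rV[R]_n) (L C s : R).
Hypotheses (L0 : 0 < L) (wP : caratheodory_field T w L C) (sT : 0 <= s <= T).
Hypothesis wd : forall t x, 0 <= t <= T -> differentiable (w t) x.

Lemma variational_norm_le t x z : 0 <= t <= T -> `|'d (w t) x z| <= L * `|z|.
Proof.
by move=> tT; apply: diff_norm_le (wd _ tT) _ => a b; have [wL _ _] := wP; exact: wL.
Qed.

(** The integrand is a pointwise limit of difference quotients, each a superposition of w with
    measurable curves. *)
Lemma variational_measurable y z : rV_measurable_fun `[0, T] y -> rV_measurable_fun `[0, T] z ->
  rV_measurable_fun `[0, T] (fun t => 'd (w t) (y t) (z t)).
Proof.
move=> my mz i; have [_ _ mw] := wP.
apply: (@measurable_fun_cvg _ (leb_time R) R _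
  (fun k t => (k.+1%:R *: (w t (y t + k.+1%:R^-1 *: z t) - w t (y t))) ord0 i)); last first.
  move=> t /=; rewrite in_itv/= => tT.
  exact: cvg_comp (diff_quotient_cvg (wd (y t) tT)) (@coord_continuous _ _ _ _ _ _).
move=> k; have myz := rV_measurableD my (rV_measurableZ k.+1%:R^-1 mz).
exact: (rV_measurableZ k.+1%:R (rV_measurableB (mw _ myz) (mw _ my)) i).
Qed.

(** Existence, uniqueness and stability thus apply to the linearised equation, with the same
    constant L. *)
Lemma variational_field y : rV_measurable_fun `[0, T] y ->
  caratheodory_field T (fun t => 'd (w t) (y t)) L 0.
Proof.
move=> my; split.
- by move=> t a b tT; rewrite -linearB; exact: variational_norm_le.
- by move=> t tT; rewrite linear0 normr0.
- by move=> z mz; exact: variational_measurable.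
Qed.

(** The candidate differential is the flow Z of the linearised equation. An increment of the flow is
    compared with Z(h) by [ode_stability], and the defect is the first-order remainder of w along
    y. *)
Theorem flow_diff t x : 0 <= t <= T -> differentiable (flow T w s t) x /\
  forall h, 'd (flow T w s t) x h =
    flow T (fun tau => 'd (w tau) (flow T w s tau x)) s t h.
Proof.
move=> tT.
have [wL _ mw] := wP.
pose y tau := flow T w s tau x.
have my : rV_measurable_fun `[0, T] y by exact: (flow_measurable T0 L0 wP sT x).
have vP := variational_field my.
pose A tau := 'd (w tau) (y tau).
pose Z tau := flow T (fun tau => A tau) s tau.
have Zlin : linear (Z t) by exact: (flow_linear L0 vP sT tT).
pose Zmix := GRing.isLinear.Build R 'rV[R]_n 'rV[R]_n *:%R (Z t) Zlin.
pose df : {linear 'rV[R]_n -> 'rV[R]_n} := HB.pack (Z t) Zmix.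
pose K := 2 * expR (2 * L * T).
have K0 : 0 < K by rewrite mulr_gt0// expR_gt0.
have ZK tau h : 0 <= tau <= T -> `|Z tau h| <= K * `|h|.
  move=> tauT; have := flow_lipschitz T0 L0 vP sT h 0 tauT.
  rewrite subr0 (_ : flow _ _ _ _ 0 = 0) ?subr0//.
  have Ztl : linear (Z tau) by exact: (flow_linear L0 vP sT tauT).
  by have := Ztl (-1) h h; rewrite scaleN1r addNr scaleN1r addNr.
have dfc : continuous df.
  by apply: (lipschitz_continuous K0) => a b; exact: (flow_lipschitz T0 L0 vP sT).
suff [dd dE] : differentiable (flow T w s t) x /\
    'd (flow T w s t) x = df :> ('rV[R]_n -> 'rV[R]_n).
  by split=> [|h]; [apply dd|apply (congr1 (fun F : 'rV[R]_n -> 'rV[R]_n => F h) dE)].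
apply: (diff_seq dfc) => h h0 hN0 e e0.
  have hp k : 0 < `|h k| by rewrite normr_gt0.
pose r k tau := w tau (y tau + Z tau (h k)) - w tau (y tau) - A tau (Z tau (h k)).
(* Relative remainder: it is at most 2 L K, and at each time it tends to 0 because w tau is
   differentiable at y tau and |Z tau (h k)| <= K |h k|. Dominated convergence then applies. *)
pose g k tau := `|h k|^-1 * `|r k tau|.
have rB k tau : 0 <= tau <= T -> `|r k tau| <= 2 * L * K * `|h k|.
  move=> tauT; apply: le_trans (ler_normB _ _) _.
  have -> : 2 * L * K * `|h k| = L * (K * `|h k|) + L * (K * `|h k|) by ring.
  rewrite lerD//.
    apply: le_trans (wL _ _ _ tauT) _.
    by rewrite addrAC subrr add0r ler_wpM2l ?(ltW L0)// ZK.
  apply: le_trans (variational_norm_le _ _ tauT) _.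
  by rewrite ler_wpM2l ?(ltW L0)// ZK.
have mZ k : rV_measurable_fun `[0, T] (fun tau => Z tau (h k)).
  exact: (flow_measurable T0 L0 vP sT (h k)).
have mr k : rV_measurable_fun `[0, T] (r k).
  exact: (rV_measurableB (rV_measurableB (mw _ (rV_measurableD my (mZ k))) (mw _ my))
    (variational_measurable my (mZ k))).
have mg k : measurable_fun (`[0, T] : set (leb_time R)) (g k).
  exact: measurable_funM (measurable_cst _) (rV_measurable_norm (mr k)).
have gc : \int[mu]_(tau in `[0, T]) g k tau @[k --> \oo] --> 0.
  apply: (leb_dominated_cvg0 mg (B := 2 * L * K)).
    exists set0; split; [exact: measurable0|exact: measure0|].
    move=> tau /= []; move=> tauT; apply/cvgrPdist_le => d d0.
    have ZT0 : Z tau (h k) @[k --> \oo] --> (0 : 'rV[R]_n).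
      by apply: (norm_le_cvg0 K0 _ h0) => k; exact: ZK.
    have Hr : \forall k \near \oo, `|r k tau| <= d / K * `|Z tau (h k)|.
      exact: (ZT0 _ (diff_remainder (wd (y tau) tauT) (divr_gt0 d0 K0))).
    apply: filterS Hr => k Hr; rewrite sub0r normrN ger0_norm ?mulr_ge0// ?invr_ge0//.
    rewrite /g mulrC ler_pdivrMr//; apply: (le_trans Hr).
    by rewrite mulrAC ler_pdivrMr// -mulrA [_ * K]mulrC ler_wpM2l ?ZK// ltW.
  move=> k tau tauT; rewrite /g ger0_norm ?mulr_ge0// ?invr_ge0//.
  by rewrite mulrC ler_pdivrMr// rB.
(* The factor K of the stability estimate turns this threshold into e |h k|. *)
have gK : \forall k \near \oo, \int[mu]_(tau in `[0, T]) g k tau < e / K.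
  have /cvgrPdist_lt/(_ _ (divr_gt0 e0 K0)) := gc.
  by apply: filterS => k; rewrite sub0r normrN; apply: le_lt_trans; exact: ler_norm.
near \oo => k; exists k.
(* The field recentred at y: the increment eta of the flow solves it with initial value h k, it is
   still L-Lipschitz, and along Z(h k) it differs from the linearised field by exactly r k. *)
pose wk tau z := w tau (y tau + z) - w tau (y tau).
pose eta tau := flow T w s tau (x + h k) - y tau.
have etaP : solves_ode T wk s (h k) eta.
  have /solves_odeP[yi ye] := flow_solves T0 L0 wP sT x.
  have /solves_odeP[y'i y'e] := flow_solves T0 L0 wP sT (x + h k).
  have E : (fun tau => wk tau (eta tau)) =
      (fun tau => -1 *: w tau (y tau) + w tau (flow T w s tau (x + h k))).
    by apply/funext => tau; rewrite /wk /eta [y tau + _]addrC subrK scaleN1r addrC.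
  apply/solves_odeP; rewrite E; split; first exact: vintZD.
  move=> u uT; rewrite ointZD// scaleN1r /eta y'e// {1}/y ye//.
  by move: (oint _ _ _) (oint _ _ _) => F Y; apply/rowP => i; rewrite !mxE; ring.
have wkL tau a b : 0 <= tau <= T -> `|wk tau a - wk tau b| <= L * `|a - b|.
  move=> tauT; rewrite /wk opprB addrA subrK; apply: le_trans (wL _ _ _ tauT) _.
  by rewrite opprD addrACA subrr add0r.
have rki : mu.-integrable `[0, T] (EFin \o (fun tau => `|r k tau|)).
  apply: measurable_bounded_integrable; [exact: itv_leb_measurable|exact: leb_itv_lty| |].
    exact: rV_measurable_norm.
  exists (2 * L * K * `|h k|); split; first exact: num_real.
  move=> b lb tau /=; rewrite in_itv/= => tauT.
  by rewrite normr_id (le_trans (rB k _ tauT))// ltW.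
have := ode_stability T0 L0 sT wkL etaP (flow_solves T0 L0 vP sT (h k)) rki.
move=> /(_ _ _ t tT)/le_trans.
rewrite subrr normr0 add0r -/(Z t) -mulrA [_ * expR _]mulrC mulrA -/K => H.
rewrite /df/=; apply: H => //.
have -> : \int[mu]_(tau in `[0, T]) `|r k tau| = `|h k| * \int[mu]_(tau in `[0, T]) g k tau.
  rewrite -RintegralZl//; last 2 first.
  - exact: itv_leb_measurable.
  - exact: (integrableZl (itv_leb_measurable _) _ rki).
  by apply: eq_Rintegral => tau _; rewrite /g mulrA divff ?mul1r// gt_eqF.
rewrite mulrCA mulrC ler_wpM2r// -ler_pdivlMl// mulrC ltW//.
by near: k.
Unshelve. all: by end_near. Qed.

Lemma flow_differentiable t x : 0 <= t <= T -> differentiable (flow T w s t) x.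
Proof. by move=> tT; have [] := flow_diff x tT. Qed.

Lemma flow_diffE t x h : 0 <= t <= T -> 'd (flow T w s t) x h =
  flow T (fun tau => 'd (w tau) (flow T w s tau x)) s t h.
Proof. by move=> tT; have [_] := flow_diff x tT. Qed.
End differentiability.
End variational_equation.

(** * Continuous dependence on the field *)

Lemma norm_sub_le_cvg (R : realType) (V : normedModType R) (u : nat -> V) (l : V) (c : nat -> R) :
  (forall k, `|u k - l| <= c k) -> c @ \oo --> 0 -> u @ \oo --> l.
Proof.
move=> uc /cvgrPdist_lt c0; apply/cvgrPdist_lt => e e0.
apply: filterS (c0 _ e0) => k; rewrite sub0r normrN distrC => ce.
by apply: le_lt_trans (uc k) _; apply: le_lt_trans ce; exact: ler_norm.
Qed.

Lemma eq_seq_cvg (V : topologicalType) (u v : nat -> V) (l l' : V) :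
  u =1 v -> l = l' -> v @ \oo --> l' -> u @ \oo --> l.
Proof. by move=> /funext-> ->. Qed.

Lemma cvg_dist0 (R : realType) (V : normedModType R) (u : nat -> V) (l : V) :
  u @ \oo --> l -> `|u k - l| @[k --> \oo] --> 0.
Proof.
move=> ul; have : `|u k - l| @[k --> \oo] --> `|l - l|.
  by apply: cvg_norm; apply: cvgB => //; exact: cvg_cst.
by rewrite subrr normr0.
Qed.

Section continuous_dependence.
Variable R : realType.
Notation mu := (@completed_lebesgue_measure R).
Variables (n : nat) (T : R).
Hypothesis T0 : 0 < T.

Section field_sequence.
Variables (w : R -> 'rV[R]_n -> 'rV[R]_n) (wk : nat -> R -> 'rV[R]_n -> 'rV[R]_n).
Variables (L C s : R).
Hypotheses (L0 : 0 < L) (sT : 0 <= s <= T).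
Hypothesis wP : caratheodory_field T w L C.
Hypothesis wkP : forall k, caratheodory_field T (wk k) L C.
Hypothesis wkw : {ae mu, forall t : R, 0 <= t <= T -> \forall k \near \oo, wk k t = w t}.
Variables (x : 'rV[R]_n) (xk : nat -> 'rV[R]_n).
Hypothesis xkx : xk @ \oo --> x.

Lemma flow_bounded : exists2 B, 0 <= B & forall t, 0 <= t <= T -> `|flow T w s t x| <= B.
Proof.
exists (`|x| + 2 * ((C + L * `|x|) * T) * expR (2 * L * T)).
  by rewrite addr_ge0// (le_trans _ (flow_dist T0 L0 wP sT x sT)).
move=> t tT; have := flow_dist T0 L0 wP sT x tT.
by have := ler_normD (flow T w s t x - x) x; rewrite subrK; lra.
Qed.

Lemma stability_cvg (a : nat -> R) (g : nat -> R -> R) (K : R) : a @ \oo --> 0 ->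
  \int[mu]_(t in `[0, T]) g k t @[k --> \oo] --> 0 ->
  2 * (a k + \int[mu]_(t in `[0, T]) g k t) * K @[k --> \oo] --> 0.
Proof.
move=> a0 g0.
have c (b : R) : (fun=> b) @ \oo --> b by exact: cvg_cst.
have : 2 * (a k + \int[mu]_(t in `[0, T]) g k t) * K @[k --> \oo] --> 2 * ((0 : R) + 0) * K.
  by apply: cvgM (c K); apply: cvgM (c 2) _; exact: cvgD.
by rewrite addr0 mulr0 mul0r.
Qed.

(** Along the limit trajectory the difference of the fields is bounded, and at almost every time it
    is eventually zero. *)
Lemma flow_seq_cvg t : 0 <= t <= T -> flow T (wk k) s t (xk k) @[k --> \oo] --> flow T w s t x.
Proof.
move=> tT.
have [B B0 yB] := flow_bounded.
pose y tau := flow T w s tau x.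
have my : rV_measurable_fun `[0, T] y by exact: (flow_measurable T0 L0 wP sT x).
pose e k tau := `|wk k tau (y tau) - w tau (y tau)|.
have eB k tau : 0 <= tau <= T -> `|e k tau| <= 2 * (C + L * B).
  move=> tauT; rewrite normr_id; apply: le_trans (ler_normB _ _) _.
  rewrite mulr2n mulrDl mul1r; apply: lerD.
    apply: le_trans (field_growth (wkP k) _ tauT) _.
    by rewrite lerD2l ler_wpM2l ?(ltW L0)// yB.
  apply: le_trans (field_growth wP _ tauT) _.
  by rewrite lerD2l ler_wpM2l ?(ltW L0)// yB.
have me k : measurable_fun (`[0, T] : set (leb_time R)) (e k).
  apply: rV_measurable_norm; apply: rV_measurableB.
    by have [_ _] := wkP k; exact.
  by have [_ _] := wP; exact.
have e0 : \int[mu]_(tau in `[0, T]) e k tau @[k --> \oo] --> 0.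
  apply: (leb_dominated_cvg0 me _ eB).
  have [N [mN N0 wN]] := wkw; exists N; split => // tau /= ntau; apply: wN => /= weq.
  apply: ntau => tauT; apply: cvg_near_cst; apply: filterS (weq tauT) => k wkE.
  by rewrite /e wkE subrr normr0.
apply: norm_sub_le_cvg (stability_cvg (expR (2 * L * T)) (cvg_dist0 xkx) e0) => k.
have [wkL _ _] := wkP k.
have eki : mu.-integrable `[0, T] (EFin \o e k).
  apply: measurable_bounded_integrable; [exact: itv_leb_measurable|exact: leb_itv_lty|exact: me|].
  exists (2 * (C + L * B)); split; first exact: num_real.
  by move=> b lb tau /=; rewrite in_itv/= => tauT; rewrite (le_trans (eB k _ tauT))// ltW.
exact: (ode_stability T0 L0 sT wkL (flow_solves T0 L0 (wkP k) sT (xk k))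
  (flow_solves T0 L0 wP sT x) eki (fun tau => normr_ge0 _) (fun tau _ => lexx _) tT).
Qed.
End field_sequence.

Section differential_sequence.
Variables (w : R -> 'rV[R]_n -> 'rV[R]_n) (wk : nat -> R -> 'rV[R]_n -> 'rV[R]_n).
Variables (L C s : R).
Hypotheses (L0 : 0 < L) (sT : 0 <= s <= T).
Hypothesis wP : caratheodory_field T w L C.
Hypothesis wkP : forall k, caratheodory_field T (wk k) L C.
Hypothesis wkw : {ae mu, forall t : R, 0 <= t <= T -> \forall k \near \oo, wk k t = w t}.
Hypothesis wd : forall t x, 0 <= t <= T -> differentiable (w t) x.
Hypothesis wkd : forall k t x, 0 <= t <= T -> differentiable (wk k t) x.
Hypothesis wC1 : forall t e, 0 <= t <= T -> continuous ('D_e (w t)).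
Variables (x : 'rV[R]_n) (xk : nat -> 'rV[R]_n).
Hypothesis xkx : xk @ \oo --> x.

(** The linearised fields do not eventually coincide, since their base points yk and y differ, so
    [flow_seq_cvg] cannot be applied to them. At almost every time they converge along z: eventually
    wk = w, yk tends to y, and the directional derivatives of w are continuous in space. *)
Lemma flow_diff_seq_cvg t h : 0 <= t <= T ->
  'd (flow T (wk k) s t) (xk k) h @[k --> \oo] --> 'd (flow T w s t) x h.
Proof.
move=> tT.
apply: (@eq_seq_cvg _ _
    (fun k => flow T (fun tau => 'd (wk k tau) (flow T (wk k) s tau (xk k))) s t h) _
    (flow T (fun tau => 'd (w tau) (flow T w s tau x)) s t h)) => [k||].
- exact: (flow_diffE T0 L0 (wkP k) sT (wkd k)).
- exact: (flow_diffE T0 L0 wP sT wd).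
pose y tau := flow T w s tau x.
pose yk k tau := flow T (wk k) s tau (xk k).
have my : rV_measurable_fun `[0, T] y by exact: (flow_measurable T0 L0 wP sT x).
have myk k : rV_measurable_fun `[0, T] (yk k) by exact: (flow_measurable T0 L0 (wkP k) sT (xk k)).
have vP := variational_field wP wd my.
have vkP k := variational_field (wkP k) (wkd k) (myk k).
have [B B0 zB] := flow_bounded L0 sT vP h.
pose z tau := flow T (fun tau => 'd (w tau) (y tau)) s tau h.
have mz : rV_measurable_fun `[0, T] z by exact: (flow_measurable T0 L0 vP sT h).
pose e k tau := `|'d (wk k tau) (yk k tau) (z tau) - 'd (w tau) (y tau) (z tau)|.
have eB k tau : 0 <= tau <= T -> `|e k tau| <= 2 * (L * B).
  move=> tauT; rewrite normr_id; apply: le_trans (ler_normB _ _) _.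
  rewrite mulr2n mulrDl mul1r; apply: lerD.
    apply: le_trans (variational_norm_le (wkP k) (wkd k) _ _ tauT) _.
    by rewrite ler_wpM2l ?(ltW L0)// zB.
  apply: le_trans (variational_norm_le wP wd _ _ tauT) _.
  by rewrite ler_wpM2l ?(ltW L0)// zB.
have me k : measurable_fun (`[0, T] : set (leb_time R)) (e k).
  exact: (rV_measurable_norm (rV_measurableB
    (variational_measurable (wkP k) (wkd k) (myk k) mz) (variational_measurable wP wd my mz))).
have e0 : \int[mu]_(tau in `[0, T]) e k tau @[k --> \oo] --> 0.
  apply: (leb_dominated_cvg0 me _ eB).
  have [N [mN N0 wN]] := wkw; exists N; split => // tau /= ntau; apply: wN => /= weq.
  apply: ntau => tauT.
  have yky := flow_seq_cvg L0 sT wP wkP wkw xkx tauT.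
  have Dcv : `|'D_(z tau) (w tau) (yk k tau) - 'D_(z tau) (w tau) (y tau)| @[k --> \oo] --> 0.
    have yD := cvg_comp _ _ yky (@wC1 tau (z tau) tauT (y tau)).
    exact: cvg_dist0 yD.
  apply: cvg_trans Dcv; apply: near_eq_cvg; apply: filterS (weq tauT) => k wkE.
  have DE a : 'D_(z tau) (w tau) a = 'd (w tau) a (z tau) by exact: (deriveE _ (wd a tauT)).
  by rewrite /e wkE (DE (yk k tau)) (DE (y tau)).
have hh : (fun=> `|h - h|) @ \oo --> (0 : R) by rewrite subrr normr0; exact: cvg_cst.
apply: norm_sub_le_cvg (stability_cvg (expR (2 * L * T)) hh e0) => k.
have [vkL _ _] := vkP k.
have eki : mu.-integrable `[0, T] (EFin \o e k).
  apply: measurable_bounded_integrable; [exact: itv_leb_measurable|exact: leb_itv_lty|exact: me|].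
  exists (2 * (L * B)); split; first exact: num_real.
  by move=> b lb tau /=; rewrite in_itv/= => tauT; rewrite (le_trans (eB k _ tauT))// ltW.
exact: (ode_stability T0 L0 sT vkL (flow_solves T0 L0 (vkP k) sT h)
  (flow_solves T0 L0 vP sT h) eki (fun tau => normr_ge0 _) (fun tau _ => lexx _) tT).
Qed.

End differential_sequence.
End continuous_dependence.

(** * Jacobian determinants and densities *)

Lemma cvg_det (R : realType) n (A : nat -> 'M[R]_n) (B : 'M[R]_n) :
  (forall i j, A k i j @[k --> \oo] --> B i j) -> \det (A k) @[k --> \oo] --> \det B.
Proof.
move=> AB; rewrite /determinant.
apply: (cvg_big (op := +%R)) => [|s _]; first exact: add_continuous.
apply: cvgM; first exact: cvg_cst.
exact: (@cvg_big R _ *%R 1 xpredT (@mul_continuous R) nat \oo (index_enum _)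
  (fun i k => A k i (s i))
  (fun i => B i (s i)) _ (fun i _ => AB i (s i))).
Qed.

Lemma mulmx1_det_neq0 (F : fieldType) n (A B : 'M[F]_n) : A *m B = 1%:M -> \det B != 0.
Proof. by move=> /mulmx1_unit[_]; rewrite unitmxE unitfE. Qed.

Section density_dependence.
Variable R : realType.
Notation mu := (@completed_lebesgue_measure R).
Variables (n : nat) (T : R).
Hypothesis T0 : 0 < T.

Lemma solves_ode_restart (w : R -> 'rV[R]_n -> 'rV[R]_n) s s' x y :
  0 <= s <= T -> 0 <= s' <= T -> solves_ode T w s x y -> solves_ode T w s' (y s') y.
Proof.
move=> sT s'T sol i; have [fi ye] := sol i; split => // t tT.
rewrite (ye t tT) (ye s' s'T).
rewrite (oriented_integralE sT tT fi) (oriented_integralE sT s'T fi) (oriented_integralE s'T tT fi).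
by ring.
Qed.

Lemma solves_ode_init (w : R -> 'rV[R]_n -> 'rV[R]_n) s x y :
  0 <= s <= T -> solves_ode T w s x y -> y s = x.
Proof.
move=> sT sol; apply/rowP => i; have [fi ye] := sol i.
by rewrite (ye s sT) (oriented_integralE sT sT fi) subrr addr0.
Qed.

Section flow_jacobian.
Variables (w : R -> 'rV[R]_n -> 'rV[R]_n) (L C : R).
Hypotheses (L0 : 0 < L) (wP : caratheodory_field T w L C).

Lemma flowK s t x : 0 <= s <= T -> 0 <= t <= T -> flow T w s t (flow T w t s x) = x.
Proof.
move=> sT tT; have sol := flow_solves T0 L0 wP tT x.
have sol' := solves_ode_restart tT sT sol.
rewrite (flow_unique T0 L0 wP sT sol' tT).
exact: (solves_ode_init tT sol).
Qed.

Hypothesis wd : forall t x, 0 <= t <= T -> differentiable (w t) x.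

(** Chain rule applied to [flowK]. Jacobians act on row vectors from the right, so the map applied
    first stands on the left. It makes the determinant in the density nonzero. *)
Lemma flow_jacobianK s t x : 0 <= s <= T -> 0 <= t <= T ->
  jacobian (flow T w t s) x *m jacobian (flow T w s t) (flow T w t s x) = 1%:M.
Proof.
move=> sT tT.
have df := flow_differentiable T0 L0 wP tT wd x sT.
have dg := flow_differentiable T0 L0 wP sT wd (flow T w t s x) tT.
have E : flow T w s t \o flow T w t s = id by apply/funext => z; exact: flowK.
have D h : 'd (flow T w s t) (flow T w t s x) ('d (flow T w t s) x h) = h.
  have Dc := congr1 (fun F : 'rV[R]_n -> 'rV[R]_n => F h) (diff_comp df dg).
  apply: (etrans (esym Dc)); rewrite E.
  have [_ Did] := is_diff_id x.
  exact: (congr1 (fun F : 'rV[R]_n -> 'rV[R]_n => F h) Did).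
apply/row_matrixP => i; rewrite !rowE mulmx1 mulmxA /jacobian.
etransitivity; last exact: (D (delta_mx 0 i)).
etransitivity; first exact: (mul_rV_lin1 ('d (flow T w s t) (flow T w t s x)) _).
congr ('d _ _ _).
exact: (mul_rV_lin1 ('d (flow T w t s) x) _).
Qed.

Lemma flow_det_jacobian_neq0 s t x : 0 <= s <= T -> 0 <= t <= T ->
  \det (jacobian (flow T w s t) (flow T w t s x)) != 0.
Proof.
move=> sT tT; exact: (mulmx1_det_neq0 (flow_jacobianK x sT tT)).
Qed.
End flow_jacobian.

Section density_sequence.
Variables (w : R -> 'rV[R]_n -> 'rV[R]_n) (wk : nat -> R -> 'rV[R]_n -> 'rV[R]_n).
Variables (L C : R).
Hypotheses (L0 : 0 < L).
Hypothesis wP : caratheodory_field T w L C.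
Hypothesis wkP : forall k, caratheodory_field T (wk k) L C.
Hypothesis wkw : {ae mu, forall t : R, 0 <= t <= T -> \forall k \near \oo, wk k t = w t}.
Hypothesis wd : forall t x, 0 <= t <= T -> differentiable (w t) x.
Hypothesis wkd : forall k t x, 0 <= t <= T -> differentiable (wk k t) x.
Hypothesis wC1 : forall t e, 0 <= t <= T -> continuous ('D_e (w t)).
Variables (x : 'rV[R]_n) (xk : nat -> 'rV[R]_n).
Hypothesis xkx : xk @ \oo --> x.

Lemma flow_det_jacobian_seq_cvg s t : 0 <= s <= T -> 0 <= t <= T ->
  \det (jacobian (flow T (wk k) s t) (xk k)) @[k --> \oo] --> \det (jacobian (flow T w s t) x).
Proof.
move=> sT tT; apply: cvg_det => i j.
have dc := @flow_diff_seq_cvg R n T T0 w wk L C s L0 sT wP wkP wkw wd wkd wC1 x xk xkx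
  t (delta_mx 0 i) tT.
have := cvg_comp _ _ dc (@coord_continuous _ _ _ ord0 j _).
apply: eq_seq_cvg => [k|]; by rewrite /jacobian mxE.
Qed.

End density_sequence.

Lemma density_seq_cvg (w : R -> 'rV[R]_n -> 'rV[R]_n) (wk : nat -> R -> 'rV[R]_n -> 'rV[R]_n)
    (L C : R) (rho0 : 'rV[R]_n -> R) (x : 'rV[R]_n) (xk : nat -> 'rV[R]_n) :
  0 < L -> caratheodory_field T w L C -> (forall k, caratheodory_field T (wk k) L C) ->
  {ae mu, forall t : R, 0 <= t <= T -> \forall k \near \oo, wk k t = w t} ->
  (forall t x, 0 <= t <= T -> differentiable (w t) x) ->
  (forall k t x, 0 <= t <= T -> differentiable (wk k t) x) ->
  (forall t e, 0 <= t <= T -> continuous ('D_e (w t))) ->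
  continuous rho0 -> xk @ \oo --> x ->
  rho0 (flow T (wk k) T 0 (xk k)) /
    \det (jacobian (flow T (wk k) 0 T) (flow T (wk k) T 0 (xk k))) @[k --> \oo] -->
  rho0 (flow T w T 0 x) / \det (jacobian (flow T w 0 T) (flow T w T 0 x)).
Proof.
move=> L0 wP wkP wkw wd wkd wC1 crho xkx.
have TT : 0 <= T <= T by rewrite lexx ltW.
have T00 : (0 : R) <= 0 <= T by rewrite lexx ltW.
have yc := flow_seq_cvg T0 L0 TT wP wkP wkw xkx T00.
have dc := flow_det_jacobian_seq_cvg L0 wP wkP wkw wd wkd wC1 yc T00 TT.
have rc := cvg_comp _ _ yc (crho (flow T w T 0 x)).
apply: cvgM; first exact: rc.
apply: cvgV; last exact: dc.
exact: (flow_det_jacobian_neq0 L0 wP wd).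
Qed.
End density_dependence.

(** * Integrals over compact sets *)

Section integral_of_close_functions.
Context d (T : measurableType d) (R : realType) (mu : {measure set T -> \bar R}).
Local Open Scope ereal_scope.
Import HBNNSimple.

(** The integral of a nonnegative function is a supremum over the simple functions below its
    extension by zero, so pointwise order suffices even when the functions or domains are not known
    to be measurable. *)
Lemma ge0_integral_mono (D A : set T) (k g : T -> \bar R) :
  (forall x, D x -> 0 <= k x) -> (forall x, A x -> 0 <= g x) ->
  (forall x, (k \_ D) x <= (g \_ A) x) ->
  \int[mu]_(x in D) k x <= \int[mu]_(x in A) g x.
Proof.
move=> k0 g0 kg; rewrite (ge0_integralE _ k0) (ge0_integralE _ g0).
apply: ge_ereal_sup => _ [h hk <-]; apply: ereal_sup_ubound; exists h => // x.
exact: le_trans (hk x) (kg x).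
Qed.

Variables (A : set T) (c : R).
Hypothesis Ac : forall S, measurable S -> S `<=` A -> mu S <= c%:E.

(* A simple function h below f is compared with max(h - delta, 0), which is below g. *)
Lemma ge0_integral_le_shift (f g : T -> R) (delta : R) : (0 <= delta)%R ->
  (forall x, A x -> 0 <= f x)%R -> (forall x, A x -> 0 <= g x)%R ->
  (forall x, A x -> f x <= g x + delta)%R ->
  \int[mu]_(x in A) (f x)%:E <= \int[mu]_(x in A) (g x)%:E + (delta * c)%:E.
Proof.
move=> d0 f0 g0 fg; rewrite [leLHS]ge0_integralE; last by move=> x Ax; rewrite lee_fin f0.
apply: ge_ereal_sup => _ [h hf <-].
(* The support of h is a measurable subset of A, so lowering h by delta there costs at most delta *
   c, by [Ac]. *)
pose S := [set x | (0 < h x)%R].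
have mh : measurable_fun setT h by [].
have mS : measurable S.
  rewrite (_ : S = h @^-1` `]0%R, +oo[); last first.
    by apply/seteqP; split=> x; rewrite /S/= in_itv/= andbT.
  by rewrite -[X in measurable X]setTI; exact: mh.
have hA x : (~ A x -> h x = 0)%R.
  move=> nAx; have := hf x; rewrite patchE memNset// lee_fin => hx0.
  by apply/eqP; rewrite eq_le hx0/=.
have SA : S `<=` A by move=> x Sx; apply: contrapT => /hA h0; move: Sx; rewrite /S/= h0 ltxx.
have hfA x : A x -> (h x <= f x)%R.
  by move=> Ax; have := hf x; rewrite patchE mem_set// lee_fin.
pose k x := Num.max (h x - delta)%R 0%R.
have k0 x : (0 <= k x)%R by rewrite /k le_max lexx orbT.
have mk : measurable_fun setT k.
  by apply: measurable_maxr => //; apply: measurable_funB => //; exact: measurable_cst.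
have -> : sintegral mu h = \int[mu]_x (h x)%:E.
  by rewrite integral_nnsfun//; apply: eq_sintegral => x; rewrite patchE in_setT.
apply: (@le_trans _ _ (\int[mu]_x ((k x)%:E + (delta * \1_S x)%:E))).
  apply: ge0_le_integral => //.
  - by move=> x _; rewrite lee_fin.
  - exact/measurable_EFinP.
  - apply: emeasurable_funD; apply/measurable_EFinP => //.
    by apply: measurable_funM => //; exact: measurable_indic.
  - move=> x _; rewrite -EFinD lee_fin indicE /k.
    have [xS|xS] := boolP (x \in S).
      by rewrite mulr1 -lerBlDr le_max lexx.
    have : (h x <= 0)%R by rewrite leNgt; apply: contra xS => hx; rewrite inE.
    by rewrite mulr0 addr0 le_max => ->; rewrite orbT.
rewrite ge0_integralD//; first last.
- by apply/measurable_EFinP; apply: measurable_funM => //; exact: measurable_indic.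
- by move=> x _; rewrite lee_fin mulr_ge0.
- exact/measurable_EFinP.
- by move=> x _; rewrite lee_fin.
apply: leeD.
  apply: ge0_integral_mono => x.
  - by rewrite lee_fin.
  - by move=> Ax; rewrite lee_fin g0.
  - rewrite [X in X <= _]patchE in_setT patchE; case: ifPn => [|nA].
      rewrite inE => Ax; rewrite lee_fin /k ge_max g0// andbT lerBlDr.
      exact: le_trans (hfA x Ax) (fg x Ax).
    rewrite lee_fin /k ge_max lexx andbT hA; first by rewrite sub0r oppr_le0.
    by move=> Ax; move: nA; rewrite mem_set.
under eq_integral do rewrite EFinM.
rewrite ge0_integralZl//; last by apply/measurable_EFinP; exact: measurable_indic.
rewrite integral_indic// setIT EFinM; apply: lee_wpmul2l; first by rewrite lee_fin.
exact: Ac.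
Qed.

Lemma ge0_integral_bounded_fin_num (f : T -> R) (M : R) : (0 <= M)%R ->
  (forall x, A x -> 0 <= f x <= M)%R -> \int[mu]_(x in A) (f x)%:E \is a fin_num.
Proof.
move=> M0 fM; have f0 x : A x -> (0 <= f x)%R by move=> /fM/andP[].
rewrite ge0_fin_numE; last by apply: integral_ge0 => x Ax; rewrite lee_fin f0.
apply: le_lt_trans (ge0_integral_le_shift (g := fun=> 0%R) M0 f0 _ _) _ => //.
  by move=> x /fM/andP[_]; rewrite add0r.
by rewrite integral0 add0e ltry.
Qed.

(** The integral is by definition that of the positive part minus that of the negative part; each
    changes by at most delta * c, whence the factor 2. The bound M keeps both finite. *)
Lemma integral_close_dist_le (f g : T -> R) (delta M : R) : (0 <= delta)%R ->
  (forall x, A x -> `|f x| <= M)%R -> (forall x, A x -> `|g x| <= M)%R ->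
  (forall x, A x -> `|f x - g x| <= delta)%R ->
  (`|\int[mu]_(x in A) f x - \int[mu]_(x in A) g x| <= 2 * delta * c)%R.
Proof.
move=> d0.
wlog M0 : M / (0 <= M)%R.
  move=> H fM gM; apply: (H (Num.max M 0)%R); rewrite ?le_max ?lexx ?orbT//.
  - by move=> x /fM h; rewrite le_max h.
  - by move=> x /gM h; rewrite le_max h.
move=> fM gM fg.
pose p (h : T -> R) x := Num.max (h x) 0%R.
have pM (h : T -> R) : (forall x, A x -> `|h x| <= M)%R ->
    forall x, A x -> (0 <= p h x <= M)%R.
  move=> hM x Ax; rewrite /p le_max lexx orbT/= ge_max M0 andbT.
  exact: le_trans (ler_norm _) (hM x Ax).
pose I (h : T -> R) := fine (\int[mu]_(x in A) (p h x)%:E).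
have IE (h : T -> R) : (forall x, A x -> `|h x| <= M)%R ->
    \int[mu]_(x in A) (p h x)%:E = (I h)%:E.
  by move=> hM; rewrite fineK//; exact: ge0_integral_bounded_fin_num M0 (pM h hM).
have Ile (h k : T -> R) : (forall x, A x -> `|h x| <= M)%R -> (forall x, A x -> `|k x| <= M)%R ->
    (forall x, A x -> `|h x - k x| <= delta)%R -> (`|I h - I k| <= delta * c)%R.
  have le1 (a b : T -> R) : (forall x, A x -> `|a x| <= M)%R -> (forall x, A x -> `|b x| <= M)%R ->
      (forall x, A x -> `|a x - b x| <= delta)%R -> (I a <= I b + delta * c)%R.
    move=> aM bM ab; rewrite -lee_fin EFinD -!IE//; apply: ge0_integral_le_shift => //.
    - by move=> x /(pM a aM)/andP[].
    - by move=> x /(pM b bM)/andP[].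
    - move=> x Ax; rewrite /p ge_max; apply/andP; split.
        apply: (@le_trans _ _ (b x + delta)%R).
          by rewrite -lerBlDl; exact: le_trans (ler_norm _) (ab x Ax).
        by rewrite lerD2r le_max lexx.
      by rewrite addr_ge0// le_max lexx orbT.
  move=> hM kM hk; rewrite ler_distl; apply/andP; split.
    by rewrite lerBlDr; apply: le1 => // x Ax; rewrite distrC hk.
  exact: le1.
have RE (h : T -> R) : (forall x, A x -> `|h x| <= M)%R ->
    (\int[mu]_(x in A) h x = I h - I (fun x => - h x))%R.
  move=> hM; have hM' x : A x -> (`|- h x| <= M)%R by move=> Ax; rewrite normrN hM.
  rewrite /Rintegral integralE.
  rewrite (_ : (fun x => (h x)%:E)^\+ = fun x => (p h x)%:E); last first.
    by apply/funext => x; rewrite funeposE /p EFin_max.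
  rewrite (_ : (fun x => (h x)%:E)^\- = fun x => (p (fun x => - h x)%R x)%:E); last first.
    by apply/funext => x; rewrite funenegE /p EFin_max EFinN.
  by rewrite IE// IE.
rewrite (RE f fM) (RE g gM).
have h1 := Ile f g fM gM fg.
have h2 : (`|I (fun x => - f x)%R - I (fun x => - g x)%R| <= delta * c)%R.
  apply: Ile => x Ax; rewrite ?normrN ?fM ?gM//.
  by rewrite -opprD normrN fg.
have E (a b a' b' : R) : (a - a' - (b - b') = (a - b) - (a' - b'))%R by ring.
rewrite E.
apply: le_trans (ler_normB _ _) _.
by rewrite (_ : 2 * delta * c = delta * c + delta * c)%R; [exact: lerD|ring].
Qed.
End integral_of_close_functions.

Section integral_over_compact.
Variable R : realType.

Lemma lebesgue_outer_compact_lty n (A : set 'rV[R]_n) : compact A ->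
  exists c : R, forall S, S `<=` A -> (lebesgue_outer S <= c%:E)%E.
Proof.
move=> /compact_bounded[M [_ AM]].
have {}AM x : A x -> `|x| <= `|M| + 1.
  by move=> Ax; apply: AM => //; rewrite (le_lt_trans (ler_norm _))// ltrDl.
pose b : 'rV[R]_n := const_mx (`|M| + 1).
have b0 i : (- b) ord0 i <= b ord0 i.
  by rewrite !mxE; apply: (@le_trans _ _ 0); rewrite ?oppr_le0 addr_ge0.
pose B := box (- b) b.
have AB : A `<=` B.
  move=> x Ax i; rewrite !mxE -ler_norml.
  exact: le_trans (coord_norm_le x i) (AM x Ax).
exists (\prod_(i < n) (b ord0 i - (- b) ord0 i)) => S SA.
(* A single box followed by empty sets; as the measure is outer, this bounds every subset of A. *)
pose F (k : nat) : set 'rV[R]_n := if k is 0%N then B else set0.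
apply: (@le_trans _ _ (\sum_(k <oo) box_gauge (F k))%E).
  apply: ereal_inf_lbound; exists F => //.
  by move=> x /SA/AB Bx; exists 0%N.
rewrite (nneseries_split 0 1); last by move=> k _; exact: box_gauge_ge0.
rewrite eseries0 ?adde0; last by move=> [|k]//= _ _; exact: box_gauge0.
rewrite big_nat1 /= /box_gauge; case: ifPn => [_|_].
  by rewrite lee_fin prodr_ge0// => i _; rewrite subr_ge0.
by apply: ereal_inf_lbound; exists (- b, b).
Qed.

(** The two hypotheses express continuity of f on A and continuous convergence of fk to f. By
    compactness f is bounded on A and fk converges to it uniformly there. *)
Lemma integral_compact_seq_cvg n (A : set 'rV[R]_n) (f : 'rV[R]_n -> R)
    (fk : nat -> 'rV[R]_n -> R) : compact A ->
  (forall x (u : nat -> 'rV[R]_n), A x -> u @ \oo --> x -> f (u k) @[k --> \oo] --> f x) ->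
  (forall x (u : nat -> 'rV[R]_n) (phi : nat -> nat), A x -> u @ \oo --> x ->
    (forall k, (k <= phi k)%N) -> fk (phi k) (u k) @[k --> \oo] --> f x) ->
  \int[lebesgue_rV n]_(x in A) fk k x @[k --> \oo] --> \int[lebesgue_rV n]_(x in A) f x.
Proof.
move=> cA fc fkc.
have [c Ac] := lebesgue_outer_compact_lty cA.
have c0 : 0 <= c.
  have := Ac set0 (sub0set _).
  by rewrite (_ : lebesgue_outer set0 = 0%E) ?lee_fin//; exact: outer_measure0.
have [M AM] : exists M, forall x, A x -> `|f x| <= M.
  (* Boundedness comes from the same covering argument, the index k serving as the bound. *)
  have [N _ NA] : \forall k \near \oo, A `<=` (fun z => `|f z| <= k%:R).
    apply: ((compact_near_coveringP A).1 cA nat \oo (fun k z => `|f z| <= k%:R)) => x Ax.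
    apply: near2_seq => u phi ux kphi.
    have fb : \forall k \near \oo, `|f (u k)| <= `|f x| + 1.
      have /cvgrPdist_lt/(_ _ ltr01) := fc x u Ax ux.
      by apply: filterS => k; have := ler_normD (f (u k) - f x) (f x); rewrite subrK distrC; lra.
    near \oo => k; exists k.
    apply: (@le_trans _ _ k%:R); last by rewrite ler_nat.
    apply: (@le_trans _ _ (`|f x| + 1)); first by near: k.
    by near: k; exact: nbhs_infty_ger.
  by exists N%:R => x Ax; apply: (NA N) => //=.
apply/cvgrPdist_le => e e0.
(* Chosen so that 2 delta c <= e; c + 1 allows for c = 0. *)
pose delta := e / (2 * (c + 1)).
have d0 : 0 < delta by rewrite divr_gt0// mulr_gt0// ltr_wpDl.
have close : \forall k \near \oo, A `<=` (fun z => `|fk k z - f z| <= delta).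
  apply: ((compact_near_coveringP A).1 cA nat \oo (fun k z => `|fk k z - f z| <= delta)) => x Ax.
  apply: near2_seq => u phi ux kphi.
  have : fk (phi k) (u k) - f (u k) @[k --> \oo] --> f x - f x.
    by apply: cvgB; [exact: fkc|exact: fc].
  rewrite subrr => /cvgrPdist_le/(_ _ d0)[N _ /(_ N (leqnn N))].
  by rewrite sub0r normrN => H; exists N.
apply: filterS close => k close; rewrite distrC.
apply: (@le_trans _ _ (2 * delta * c)).
  apply: (@integral_close_dist_le _ _ _ (lebesgue_rV n) A c _ (fk k) f delta (M + delta)).
  - by move=> S _ SA; exact: Ac.
  - exact/ltW.
  - move=> x Ax; have := ler_normD (fk k x - f x) (f x); rewrite subrK.
    by have := close x Ax; have := AM x Ax; rewrite /=; lra.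
  - by move=> x Ax; have := AM x Ax; lra.
  - exact: close.
rewrite (_ : 2 * delta * c = e * (c / (c + 1))); last first.
  by rewrite /delta; field; rewrite gt_eqF// ltr_wpDl.
by rewrite ger_pMr// ler_pdivrMr ?mul1r ?lerDl// ltr_wpDl.
Unshelve. all: by end_near. Qed.
End integral_over_compact.

(** * Control systems *)

(** An open set is the union of the balls it contains whose centres lie in a countable dense family
    and whose radii are 1 / (j + 1), so measurable preimages of balls are enough. *)
Lemma open_preimage_measurable (R : realType) d (T : measurableType d) (D : set T)
    (V : pseudoMetricType R) (Q : countType) (c : Q -> V) (p : T -> V) :
  (forall (z : V) (e : R), 0 < e -> exists q, ball (c q) e z) ->
  (forall q (e : R), 0 < e -> measurable (D `&` p @^-1` ball (c q) e)) ->
  forall O, open O -> measurable (D `&` p @^-1` O).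
Proof.
move=> dense mball O oO.
pose F (qj : Q * nat) : set T :=
  if `[< ball (c qj.1) (qj.2.+1%:R^-1 : R) `<=` O >]
  then D `&` p @^-1` ball (c qj.1) (qj.2.+1%:R^-1 : R) else set0.
rewrite (_ : _ `&` _ = \bigcup_qj F qj).
  apply: countable_bigcupT_measurable; first exact: countableP.
  by move=> qj; rewrite /F; case: ifP => // _; apply: mball; rewrite invr_gt0.
apply/seteqP; split=> [t [Dt Opt]|t [qj _]]; last first.
  by rewrite /F; case: ifPn => // /asboolP sub [Dt bt]; split => //; exact: sub.
have /nbhs_ballP[e /= e0 eO] : nbhs (p t) O by exact: open_nbhs_nbhs.
(* With a radius below e / 2, a ball containing p t stays inside the ball of radius e about p t. *)
have [j] : exists j, j.+1%:R^-1 < e / 2 :> R.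
  have [N _ /(_ N (leqnn N)) HN] := near_infty_natSinv_lt (PosNum (divr_gt0 e0 (ltr0n R 2))).
  by exists N.
move=> je; have j0 : 0 < (j.+1%:R^-1 : R) by rewrite invr_gt0.
have [q qb] := dense (p t) _ j0.
exists (q, j) => //; rewrite /F ifT//=; apply/asboolP => z qz; apply: eO.
have := ball_triangle (ball_sym qb) qz; apply: le_ball.
by rewrite ltW// [e]splitr ltrD.
Qed.

Lemma rat_dense (R : realType) (x e : R) : 0 < e -> exists q : rat, `|ratr q - x| < e.
Proof.
move=> e0; have xe : x - e < x + e by rewrite ltrBlDr -addrA ltrDl addr_gt0.
have [q] := rat_in_itvoo xe; rewrite in_itv/= => xqe.
by exists q; rewrite ltr_distl.
Qed.

Section superposition_measurability.
Variable R : realType.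
Notation mu := (@completed_lebesgue_measure R).
Variables (n m : nat) (T : R).

Lemma rV_rat_dense k (z : 'rV[R]_k) (e : R) : 0 < e ->
  exists q : 'rV[rat]_k, ball (map_mx (ratr : rat -> R) q) e z.
Proof.
move=> e0.
have ex (i : 'I_k) : exists q : rat, `|ratr q - z ord0 i| < e by exact: rat_dense.
have [q qP] := choice ex.
exists (\row_i q i); split => // i j; rewrite !mxE (ord1 i) -ball_normE/=.
exact: qP.
Qed.

Lemma rV_ball_preimage_measurable k (D : set R) (y : R -> 'rV[R]_k) (a : 'rV[R]_k) (e : R) :
  measurable (D : set (leb_time R)) -> rV_measurable_fun D y -> 0 < e ->
  measurable (D `&` y @^-1` ball a e : set (leb_time R)).
Proof.
move=> mD my e0.
rewrite (_ : _ `&` _ =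
    D `&` \bigcap_(i : 'I_k) (D `&` (fun t => y t ord0 i) @^-1` ball (a ord0 i) e)).
  apply: measurableI => //; apply: fin_bigcap_measurable => [|i _].
    exact: finite_finset.
  by apply: my => //; exact: measurable_ball.
apply/seteqP; split=> [t [Dt [_ yb]]|t [Dt H]]; split => //.
  by move=> i _; split => //; exact: yb.
split => // i j; rewrite (ord1 i).
by have [_] := H j I.
Qed.

(** G is continuous only on K, so the preimage of an interval is the trace on K of some open V. The
    curve p stays in K, hence the composite has the same preimage as V under p. *)
Theorem continuous_within_measurable (K : set (R * 'rV[R]_n * 'rV[R]_m))
    (G : R * 'rV[R]_n * 'rV[R]_m -> 'rV[R]_n) (y : R -> 'rV[R]_n) (u : R -> 'rV[R]_m) :
  {within K, continuous G} ->
  rV_measurable_fun `[0, T] y -> rV_measurable_fun `[0, T] u ->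
  (forall t, 0 <= t <= T -> K (t, y t, u t)) ->
  rV_measurable_fun `[0, T] (fun t => G (t, y t, u t)).
Proof.
move=> cG my mu' Kyu i.
pose p t : R * 'rV[R]_n * 'rV[R]_m := (t, y t, u t).
have mT : measurable (`[0, T]%classic : set (leb_time R)) by exact: itv_leb_measurable.
have cGi : continuous ((fun z => G z ord0 i) : subspace K -> R).
  move=> z; exact: (cvg_comp _ _ (cG z) (@coord_continuous _ _ _ ord0 i _)).
have mO O : open O -> measurable (`[0, T] `&` p @^-1` O : set (leb_time R)).
  pose c (q : rat * 'rV[rat]_n * 'rV[rat]_m) : R * 'rV[R]_n * 'rV[R]_m :=
    (ratr q.1.1, map_mx (ratr : rat -> R) q.1.2, map_mx (ratr : rat -> R) q.2).
  apply: (@open_preimage_measurable R _ (leb_time R) `[0, T] _ _ c p).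
    move=> [[z1 z2] z3] e e0.
    have [q1 h1] := rat_dense z1 e0.
    have [q2 h2] := rV_rat_dense z2 e0; have [q3 h3] := rV_rat_dense z3 e0.
    by exists (q1, q2, q3); split => //; split => //=; rewrite -ball_normE.
  move=> [[q1 q2] q3] e e0.
  rewrite (_ : _ `&` _ = (`[0, T] `&` ball (ratr q1 : R) e) `&`
    (`[0, T] `&` y @^-1` ball (map_mx (ratr : rat -> R) q2) e) `&`
    (`[0, T] `&` u @^-1` ball (map_mx (ratr : rat -> R) q3) e)).
    apply: measurableI; last exact: rV_ball_preimage_measurable.
    apply: measurableI; last exact: rV_ball_preimage_measurable.
    by apply: measurableI => //; apply: borel_leb_measurable; exact: measurable_ball.
  by apply/seteqP; split=> t /=; [case=> ? [[]]|case=> [[[] ? ? []] ? ? [] ? ?]].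
apply: (measurability _ (RGenOpens.measurableE R)) => _ [_ [a [b ->] <-]].
have oG : open ((fun z => G z ord0 i) @^-1` `]a, b[ : set (subspace K)).
  by move: cGi => /continuousP; apply; exact: interval_open.
have [V oV VO] := (open_subspaceP _ _).1 oG.
rewrite (_ : _ `&` _ = `[0, T] `&` p @^-1` V); first exact: mO.
apply/seteqP; split=> t [tT].
  move=> H; split => //.
  suff : (V `&` K) (p t) by case.
  by rewrite VO; split => //; apply: Kyu; move: tT; rewrite /= in_itv.
move=> Vt; split => //.
suff : ((fun z => G z ord0 i) @^-1` `]a, b[ `&` K) (p t) by case.
by rewrite -VO; split => //; apply: Kyu; move: tT; rewrite /= in_itv.
Qed.
End superposition_measurability.

(** * Changes on null sets of times *)

Section ae_modification.
Variable R : realType.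
Notation mu := (@completed_lebesgue_measure R).

Lemma coord_le_enorm k (x : 'rV[R]_k) i : `|x ord0 i| <= enorm x.
Proof.
rewrite /enorm -sqrtr_sqr; apply: ler_wsqrtr.
by rewrite /dot (bigD1 i)//= -expr2 lerDl; apply: sumr_ge0 => j _; rewrite -expr2 sqr_ge0.
Qed.

Lemma norm_le_enorm k (x : 'rV[R]_k) : `|x| <= enorm x.
Proof. by apply: rV_norm_le; [exact: sqrtr_ge0|exact: coord_le_enorm]. Qed.

Lemma enorm_le_norm k (x : 'rV[R]_k) : enorm x <= k%:R * `|x|.
Proof.
rewrite -(@ger0_norm _ (k%:R * `|x|)) ?mulr_ge0// -sqrtr_sqr /enorm.
apply: ler_wsqrtr; rewrite /dot exprMn.
apply: (@le_trans _ _ (\sum_(i < k) `|x| ^+ 2)).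
  apply: ler_sum => i _; rewrite -expr2 -[leLHS]real_normK ?num_real//.
  by apply: lerXn2r; rewrite ?nnegrE//; exact: coord_norm_le.
rewrite sumr_const card_ord -[leLHS]mulr_natl ler_wpM2r ?sqr_ge0//.
by rewrite -natrX ler_nat; case: k {x} => // k; rewrite expnS expn1 leq_pmulr.
Qed.

(** Completeness enters here: the part of a preimage lying in N is an arbitrary subset of a null
    set. *)
Lemma complete_measurable_fun d (T : measurableType d) (D : set (leb_time R))
    (f g : leb_time R -> T) :
  measurable D -> measurable_fun D f -> {ae mu, forall t, D t -> f t = g t} ->
  measurable_fun D g.
Proof.
move=> mD mf [N [mN N0 fgN]] _ Y mY.
have fg t : D t -> ~ N t -> f t = g t.
  by move=> Dt Nt; apply: contrapT => nfg; apply: Nt; apply: fgN => /= H; apply: nfg; exact: H.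
rewrite (_ : D `&` g @^-1` Y = ((D `&` f @^-1` Y) `\` N) `|` (D `&` g @^-1` Y `&` N)).
  apply: measurableU; first by apply: measurableD => //; exact: mf.
  apply: completed_lebesgue_measure_is_complete; exists N.
  by split; [exact: mN|exact: N0|move=> t []].
apply/seteqP; split=> t.
  move=> [Dt Yt]; have [Nt|Nt] := pselect (N t); [by right|left].
  by split => //; split => //=; rewrite fg.
by move=> [[[Dt Yt] Nt]|[]//]; split => //=; rewrite -fg.
Qed.

Variable T : R.

Lemma leb_integrable_ae (f g : R -> R) : 
  {ae mu, forall t : R, 0 <= t <= T -> f t = g t} ->
  mu.-integrable `[0, T] (EFin \o f) ->
  mu.-integrable `[0, T] (EFin \o g) /\
  forall t, t <= T -> \int[mu]_(x in `[0, t]) f x = \int[mu]_(x in `[0, t]) g x.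
Proof.
move=> fg fi; have /integrableP[mf foo] := fi.
have fgE t : t <= T -> {ae mu, forall z, [set` `[0, t]] z -> (EFin \o f) z = (EFin \o g) z}.
  move=> tT; have [N [mN N0 fgN]] := fg; exists N; split => // z /= nz; apply: fgN => /= H.
  apply: nz; rewrite in_itv/= => /andP[z0 zt]; rewrite /= H// z0; exact: le_trans tT.
have mg : measurable_fun (`[0, T] : set (leb_time R)) (EFin \o g).
  apply: complete_measurable_fun mf (fgE T (lexx _)); exact: itv_leb_measurable.
split.
  apply/integrableP; split => //; apply: le_lt_trans foo.
  rewrite le_eqVlt; apply/orP; left; apply/eqP/ae_eq_integral.
  - exact: itv_leb_measurable.
  - by apply: measurableT_comp => //.
  - by apply: measurableT_comp => //.
  - have [N [mN N0 fgN]] := fgE T (lexx _); exists N; split => // z /= nz; apply: fgN => /= H.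
    by apply: nz => zT; exact: (congr1 abse (esym (H zT))).
move=> t tT; rewrite /Rintegral; congr fine; apply: ae_eq_integral.
- exact: itv_leb_measurable.
- by apply: measurable_funS mf; [exact: itv_leb_measurable|apply: subset_itvl; rewrite bnd_simp].
- by apply: measurable_funS mg; [exact: itv_leb_measurable|apply: subset_itvl; rewrite bnd_simp].
- exact: fgE.
Qed.

Lemma solves_ode_ae n (w w' : R -> 'rV[R]_n -> 'rV[R]_n) s x y : 0 <= s <= T ->
  {ae mu, forall t : R, 0 <= t <= T -> w t = w' t} ->
  solves_ode T w s x y -> solves_ode T w' s x y.
Proof.
move=> sT ww' sol i; have [fi ye] := sol i.
have aei : {ae mu, forall t : R, 0 <= t <= T -> w t (y t) ord0 i = w' t (y t) ord0 i}.
  have [N [mN N0 wN]] := ww'; exists N; split => // z /= nz; apply: wN => /= H.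
  by apply: nz => zT; rewrite H.
have [gi gE] := leb_integrable_ae aei fi.
split => // t tT; rewrite (ye t tT) (oriented_integralE sT tT fi) (oriented_integralE sT tT gi).
by rewrite !gE//; [case/andP: sT|case/andP: tT].
Qed.

(** The two solution sets are equal, so [xget] selects the same curve and the flows agree as
    functions. *)
Lemma flow_ae n (w w' : R -> 'rV[R]_n -> 'rV[R]_n) s t : 0 <= s <= T ->
  {ae mu, forall t : R, 0 <= t <= T -> w t = w' t} -> flow T w s t = flow T w' s t.
Proof.
move=> sT ww'; apply/funext => x; rewrite /flow.
rewrite (_ : [set y | solves_ode T w s x y] = [set y | solves_ode T w' s x y])//.
apply/seteqP; split=> y /=; apply: solves_ode_ae => //.
have [N [mN N0 wN]] := ww'; exists N; split => // z /= nz.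
by apply: wN => /= H; apply: nz => zT; rewrite H.
Qed.
End ae_modification.

Section control_field.
Variables (R : realType) (n m : nat) (T : R) (U : set 'rV[R]_m).
Variable v : R -> 'rV[R]_n -> 'rV[R]_m -> 'rV[R]_n.
Hypothesis n_gt0 : (0 < n)%N.
Notation mu := (@completed_lebesgue_measure R).

(** L and C do not depend on the control, so one pair serves u^k and all its perturbations. The
    factor n comes from comparing the Euclidean norm with the max norm, and n > 0 keeps the constant
    positive. *)
Lemma control_caratheodory_field :
  {within [set p : R * 'rV[R]_n * 'rV[R]_m | 0 <= p.1.1 <= T /\ U p.2],
     continuous (fun p => v p.1.1 p.1.2 p.2)} ->
  (exists L C : R, [/\ 0 < L, 0 < C &
     forall (t : R) (u : 'rV[R]_m), 0 <= t <= T -> U u ->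
       (forall x x', enorm (v t x u - v t x' u) <= L * enorm (x - x')) /\
       (forall x, enorm (v t x u) <= C * (1 + enorm x))]) ->
  exists L C : R, 0 < L /\ forall u, rV_measurable_fun `[0, T] u ->
    (forall t, 0 <= t <= T -> U (u t)) ->
    caratheodory_field T (fun t x => v t x (u t)) L C.
Proof.
move=> vc [L [C [L0 C0 vLC]]]; exists (L * n%:R), C; split.
  by rewrite mulr_gt0// ltr0n.
move=> u mu' uU; split.
- move=> t x x' tT; have [vL _] := vLC t (u t) tT (uU t tT).
  apply: le_trans (norm_le_enorm _) _; apply: le_trans (vL _ _) _.
  by rewrite -mulrA ler_wpM2l ?(ltW L0)//; exact: enorm_le_norm.
- move=> t tT; have [_ vC] := vLC t (u t) tT (uU t tT).
  apply: le_trans (norm_le_enorm _) _; apply: le_trans (vC 0) _.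
  have -> : enorm (0 : 'rV[R]_n) = 0.
    apply/eqP; rewrite eq_le sqrtr_ge0 andbT.
    by apply: le_trans (enorm_le_norm _) _; rewrite normr0 mulr0.
  by rewrite addr0 mulr1.
- move=> y my.
  exact: (@continuous_within_measurable R n m T _ (fun p => v p.1.1 p.1.2 p.2) y u vc my mu'
    (fun t tT => conj tT (uU t tT))).
Qed.

(** Needed because [caratheodory_field] asks for its bounds at every time of [0, T]. Values outside
    U are replaced by a fixed point of U. *)
Lemma admissible_everywhere u : U !=set0 -> admissible T U u ->
  exists u', [/\ rV_measurable_fun `[0, T] u', forall t, U (u' t) &
    {ae mu, forall t : R, 0 <= t <= T -> u t = u' t}].
Proof.
move=> [u0 U0] [mu' uU].
pose u' t := if `[< U (u t) >] then u t else u0.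
have uu' : {ae mu, forall t : R, 0 <= t <= T -> u t = u' t}.
  have [N [mN N0 uN]] := uU; exists N; split => // z /= nz; apply: uN => /= H.
  by apply: nz => zT; rewrite /u'; case: asboolP => // nU; exfalso; exact: nU (H zT).
exists u'; split; last exact: uu'.
- move=> i; apply: complete_measurable_fun (mu' i) _; first exact: itv_leb_measurable.
  have [N [mN N0 uN]] := uu'; exists N; split => // z /= nz; apply: uN => /= H.
  by apply: nz; rewrite in_itv/= => zT; rewrite H.
- by move=> t; rewrite /u'; case: asboolP.
Qed.

Lemma J_ae (rho0 : 'rV[R]_n -> R) A u u' : 0 < T ->
  {ae mu, forall t : R, 0 <= t <= T -> u t = u' t} ->
  J T v rho0 A u = J T v rho0 A u'.
Proof.
move=> T0 uu'.
have TT : 0 <= T <= T by rewrite lexx ltW.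
have T00 : (0 : R) <= 0 <= T by rewrite lexx ltW.
have ww' : {ae mu, forall t : R, 0 <= t <= T -> (fun x => v t x (u t)) = (fun x => v t x (u' t))}.
  have [N [mN N0 uN]] := uu'; exists N; split => // z /= nz; apply: uN => /= H.
  by apply: nz => zT; rewrite H.
rewrite /J /density /cflow.
by rewrite (flow_ae 0 TT ww') (flow_ae T T00 ww').
Qed.
End control_field.

(** * Needle perturbations on small sets of times *)

Section needle_sets.
Variable R : realType.
Notation mu := (@completed_lebesgue_measure R).

Lemma rV_measurable_patch m (D : set R) (f g : R -> 'rV[R]_m) (A : set R) :
  measurable (D : set (leb_time R)) -> lebesgue_measurable A ->
  rV_measurable_fun D f -> rV_measurable_fun D g -> rV_measurable_fun D (patch f A g).
Proof.
move=> mD mA mf mg i _ Y mY.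
have -> : D `&` (fun t => patch f A g t ord0 i) @^-1` Y =
    ((D `&` (fun t => g t ord0 i) @^-1` Y) `&` A) `|`
    ((D `&` (fun t => f t ord0 i) @^-1` Y) `\` A).
  apply/seteqP; split=> t.
    move=> [Dt]; rewrite /= /patch; case: ifPn => tA Yt; [left|right]; split => //.
      exact: set_mem.
    by move=> At; move: tA; rewrite mem_set.
  move=> [[[Dt Yt] At]|[[Dt Yt] At]]; split => //=; rewrite /patch.
    by rewrite mem_set.
  by rewrite memNset.
apply: measurableU; [apply: measurableI|apply: measurableD] => //.
  exact: (mg i mD Y mY).
exact: (mf i mD Y mY).
Qed.

Lemma ae_eventually_notin (I : nat -> set R) (c : R) :
  (forall k, lebesgue_measurable (I k)) ->
  (forall k, mu (I k) = (c / (2 ^ (k + 1))%:R)%:E) ->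
  {ae mu, forall t : R, \forall k \near \oo, ~ I k t}.
Proof.
move=> mI muI; exists (lim_sup_set I); split.
- apply: bigcap_measurable => [|j _]; first by exists 0%N.
  by apply: bigcup_measurable => k _; exact: mI.
- apply: lim_sup_set_cvg0 => //.
  (* The measures c / 2^(k+1) have a finite sum, so the limit superior of the sets is null. *)
  have := @cvg_geometric_eseries_half R c 0.
  rewrite (_ : (fun k => _) = (fun k => mu (I k))); last first.
    by apply/funext => k; rewrite [RHS]muI.
  by move=> /cvg_lim -> //; rewrite ltry.
- move=> t nt j _; apply: contrapT => nj; apply: nt; exists j => // k /= jk Ikt.
  by apply: nj; exists k.
Qed.
End needle_sets.

Theorem mainTheorem1 (R : realType) (n m : nat) (n_gt0 : (0 < n)%N)
  (T : R) (T_gt0 : 0 < T)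
  (U : set 'rV[R]_m) (U_neq0 : U !=set0) (U_compact : compact U)
  (v : R -> 'rV[R]_n -> 'rV[R]_m -> 'rV[R]_n)
  (rho0 : 'rV[R]_n -> R) (A : set 'rV[R]_n)
  (v_continuous :
     {within [set p : R * 'rV[R]_n * 'rV[R]_m | 0 <= p.1.1 <= T /\ U p.2],
       continuous (fun p => v p.1.1 p.1.2 p.2)})
  (v_C2 : forall (t : R) (u : 'rV[R]_m), 0 <= t <= T -> U u -> C2 (fun x => v t x u))
  (v_growth : exists L C : R, [/\ 0 < L, 0 < C &
     forall (t : R) (u : 'rV[R]_m), 0 <= t <= T -> U u ->
       (forall x x', enorm (v t x u - v t x' u) <= L * enorm (x - x')) /\
       (forall x, enorm (v t x u) <= C * (1 + enorm x))])
  (rho0_C1 : C1 (rho0 : 'rV[R]_n -> R^o))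
  (A_tube : compact_tube A)
  (v_affine : exists (l : nat) (v0 : R -> 'rV[R]_n -> 'rV[R]_n)
       (vs : 'I_l -> R -> 'rV[R]_n -> 'rV[R]_n)
       (phi : 'I_l -> R -> 'rV[R]_m -> R),
     (forall (t : R) (x : 'rV[R]_n) (u : 'rV[R]_m), 0 <= t <= T -> U u ->
        v t x u = v0 t x + \sum_(i < l) phi i t u *: vs i t x) /\
     (forall t : R, 0 <= t <= T ->
        convex_set [set (\row_(i < l) phi i t u : convex_lmodType 'rV[R]_l)
                   | u in U]))
  (u : nat -> R -> 'rV[R]_m)
  (u_admissible : forall k, admissible T U (u k))
  (u_step : forall k, needle_step T U v rho0 A (u k) (u k.+1)) :
  forall k, J T v rho0 A (u k) <= J T v rho0 A (u k.+1).

Proof.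
move=> k.
have [w [I [eps' [mw wmin Imax [/andP[eps'0 eps'T] Jmax] u'E]]]] := u_step k.
have [L [C [L0 wP]]] := control_caratheodory_field n_gt0 v_continuous v_growth.
have [u' [mu' u'U uu']] := admissible_everywhere U_neq0 (u_admissible k).
have wU t : 0 <= t <= T -> U (w t) by move=> /wmin[].
rewrite (J_ae v rho0 A T_gt0 (u' := patch (u k) (I eps') w) (u := u k.+1)); last first.
  exists set0; split; [exact: measurable0|exact: measure0|].
  by move=> t /= []; exact: u'E.
rewrite (J_ae v rho0 A T_gt0 uu').
pose eps (j : nat) : R := T / (2 ^ (j + 1))%:R.
have epsT j : 0 < eps j <= T.
  have p1 : (1 : R) <= (2 ^ (j + 1))%:R by rewrite ler1n expn_gt0.
  have p0 : (0 : R) < (2 ^ (j + 1))%:R by exact: lt_le_trans p1.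
  by rewrite /eps divr_gt0//= ler_pdivrMr// ler_peMr// ltW.
(* Patching u' instead of u^k keeps the values in U at every time of [0, T]; [ukJ] transfers the
   maximality of eps' across the null set where they differ. *)
pose uk j := patch u' (I (eps j)) w.
have Iad j : [/\ lebesgue_measurable (I (eps j)), I (eps j) `<=` `[0, T] &
    completed_lebesgue_measure (I (eps j)) = (eps j)%:E].
  by have [] := Imax (eps j) (epsT j).
have muk j : rV_measurable_fun `[0, T] (uk j).
  have [mI _ _] := Iad j; exact: rV_measurable_patch (itv_leb_measurable _) mI mu' mw.
have ukU j t : 0 <= t <= T -> U (uk j t).
  by move=> tT; rewrite /uk /patch; case: ifP => _; [exact: wU|exact: u'U].
have ukJ j : J T v rho0 A (uk j) <= J T v rho0 A (patch (u k) (I eps') w).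
  rewrite (J_ae v rho0 A T_gt0 (u' := patch (u k) (I (eps j)) w)); first exact: Jmax.
  have [N [mN N0 uN]] := uu'; exists N; split; [exact: mN|exact: N0|].
  move=> z nz; apply: uN => H; apply: nz => zT.
  by rewrite /uk /patch; case: ifP => // _; rewrite H.
have TT : 0 <= T <= T by rewrite lexx ltW.
have Iae : {ae completed_lebesgue_measure, forall t : R, \forall j \near \oo, ~ I (eps j) t}.
  by apply: (@ae_eventually_notin _ _ T) => j; have [] := Iad j.
have crho : continuous rho0 by move=> x; have [dr _] := rho0_C1; exact: differentiable_continuous.
have vd t x : 0 <= t <= T -> differentiable (fun x => v t x (u' t)) x.
  by move=> tT; have [[d _] _] := v_C2 t (u' t) tT (u'U t).
have vkd j t x : 0 <= t <= T -> differentiable (fun x => v t x (uk j t)) x.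
  by move=> tT; have [[d _] _] := v_C2 t (uk j t) tT (ukU j t tT).
have vC1 t e : 0 <= t <= T -> continuous ('D_e (fun x => v t x (u' t))).
  by move=> tT; have [[_ d] _] := v_C2 t (u' t) tT (u'U t).
have cJ : J T v rho0 A (uk j) @[j --> \oo] --> J T v rho0 A u'.
  apply: integral_compact_seq_cvg; first by have [] := A_tube.
  (* Continuity of the limit density is the case of a constant sequence of fields. *)
  - move=> x xk _ xkx; rewrite /density /cflow.
    apply: (density_seq_cvg T_gt0 L0 (wP u' mu' (fun t _ => u'U t))
      (wk := fun _ t x => v t x (u' t))) => //.
    + by move=> _; exact: (wP u' mu' (fun t _ => u'U t)).
    + exists set0; split; [exact: measurable0|exact: measure0|].
      by move=> t /= []; move=> _; exact: nearW.
  - move=> x xk phi _ xkx phij; rewrite /density /cflow.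
    apply: (density_seq_cvg T_gt0 L0 (wP u' mu' (fun t _ => u'U t))
      (wk := fun j t x => v t x (uk (phi j) t))) => //.
    + by move=> j; exact: (wP (uk (phi j)) (muk _) (ukU _)).
    (* Outside a null set t leaves every I (eps j) from some j0 on; [j <= phi j] preserves this
       after reindexing. *)
    + have [N [mN N0 IN]] := Iae; exists N; split; [exact: mN|exact: N0|].
      move=> t nt; apply: IN => -[j0 _ H]; apply: nt => tT; exists j0 => // j /= j0j.
      apply/funext => z; rewrite /uk /patch memNset//; apply: H.
      exact: leq_trans j0j (phij j).
    + by move=> j t z; exact: vkd.
apply: cvgr_to_le cJ _; exact: nearW.
Qed.
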